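(* Assume the standing hypotheses on the continuous problem and on the space discretization listed in the context. Assume also that $\partial u\neq0$ (the boundary data $g$ does not vanish), that $c_1<c_2<\dots<c_s$, that $c_i=1$ for some $i\in\{1,\dots,s\}$, and that there exist $C'$, $h_0$ such that $$\|\tau A_{h,0}e^{\tau A_{h,0}}\|_h\le C',\qquad \tau\ge0,\ h\le h_0.$$ If moreover $u\in C^2([0,T],X)$ and there is a constant $C$ (independent of $h$, $k$, $n$) with $$\Big\|kA_{h,0}\sum_{r=1}^{n-1}e^{rkA_{h,0}}\Big\|_h\le C,\qquad 0\le nk\le T,$$ then the global error of the classical Lawson full discretization satisfies $e_{h,n}=U_h^n-P_hu(t_n)=O(1+k\|C_h\|)$.
   Context: **Continuous problem.** $\Omega\subset\mathbb R^d$ is a bounded domain, $X=C(\overline\Omega)$ with the maximum norm, $Y$ is a Banach space, $A:D(A)\subset X\to X$ and $\partial:D(A)\to Y$ are linear. $u$ is the solution of $u'(t)=Au(t)+f(t,u(t))$, $0\le t\le T$, $u(0)=u_0\in X$, $\partial u(t)=g(t)\in Y$, with $f:[0,T]\times X\to X$ (in general nonlinear) and $g:[0,T]\to Y$. *Standing hypotheses on the continuous problem:* (i) $\partial:D(A)\to Y$ is onto and $g\in C^1([0,T],Y)$. (ii) $\ker\partial$ is dense in $X$ and $A_0$, the restriction of $A$ to $D(A_0)=\ker\partial$, generates a $C_0$-semigroup $\{e^{tA_0}\}_{t\ge0}$ on $X$ of negative type $\omega$. (iii) For $\Re z>0$ and $v\in Y$ the problem $Ax=zx$, $\partial x=v$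 has a unique solution $x=K(z)v$, and $\|K(z)v\|\le C\|v\|$ with $C$ uniform for $\Re z\ge\omega_0>\omega$. (iv) $f\in C^1([0,T]\times X,X)$. (v) $u\in C^1([0,T],X)$, $u(t)\in D(A)$ for all $t\in[0,T]$, $Au\in C([0,T],X)$. **Space discretization.** For a mesh parameter $h$, $\Omega_h$ is a grid with $N$ nodes; $\|\cdot\|_h$ is the maximum norm on $\mathbb C^N$ (and the induced operator norms); $P_h:X\to\mathbb C^N$ maps a function to its values on the grid; $A_{h,0}$ is an $N\times N$ matrix (discretizing $A_0$) and $C_h:Y\to\mathbb C^N$ is linear with operator norm $\|C_h\|$, so that $A$ acting on functions with $\partial u=g$ is discretized by $A_{h,0}U_h+C_hg$. The function $f$ also makes sense as a map $[0,T]\times\mathbb C^N\to\mathbb C^N$ and $P_hf(t,u)=f(t,P_hu)$ for $t\in[0,T]$, $u\in X$. *Standing hypotheses on the discretization:* (a) $\|e^{tA_{h,0}}\|_h\le1$ for $t\ge0$; $A_{h,0}$ is invertible and $\|A_{h,0}^{-1}\|_h\le C$ with $C$ independent of $h$. (b) Let $R_h:D(A)\to\mathbb C^N$ be defined by $A_{h,0}R_hu+C_h\partial u=P_hAu$. There is a subspace $Z\subset D(A)$ with norm $\|\cdot\|_Z$ such that for $u\in Z$: $A_0^{-1}u\in Z$ and $e^{tA_0}u,f(t,u)\in Z$ for $t\in[0,T]$; $\|A_{h,0}(P_hu-R_hu)\|_h\le\varepsilon_h\|u\|_Z$ and $\|P_hu-R_hu\|_h\le\eta_h\|u\|_Z$,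 with $\varepsilon_h,\eta_h$ small with $h$. Moreover $\|A_{h,0}^{-1}C_h\|_h\le C''$ with $C''$ independent of $h$. (c) $f\in C^1([0,T]\times\mathbb C^N,\mathbb C^N)$ and its derivative with respect to the variable in $\mathbb C^N$ is uniformly bounded in a neighbourhood of the solution where the numerical approximation stays. **Classical Lawson discretization (first space, then time).** Let $a_{ij}$ ($j<i$), $b_i$, $c_i$ ($1\le i\le s$) be the coefficients of an explicit Runge–Kutta tableau, with $0\le c_i\le 1$. Let $k>0$ be the time stepsize, $t_n=nk\le T$. Starting from $U_h^0=P_hu(0)$, define for $i=1,\dots,s$ $$K_{h,i}^n=e^{c_ikA_{h,0}}U_h^n+k\sum_{j=1}^{i-1}a_{ij}e^{(c_i-c_j)kA_{h,0}}[C_hg(t_n+c_jk)+f(t_n+c_jk,K^n_{h,j})],$$ $$U_h^{n+1}=e^{kA_{h,0}}U_h^n+k\sum_{i=1}^sb_ie^{(1-c_i)kA_{h,0}}[C_hg(t_n+c_ik)+f(t_n+c_ik,K_{h,i}^n)].$$ All $O(\cdot)$ bounds are in $\|\cdot\|_h$, with constants independent of $k$, (small) $h$ and $n$ with $nk\le T$. *)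

(* Defs.v *)
From HB Require Import structures.
From mathcomp Require Import all_boot all_order all_algebra.
From mathcomp Require Import complex.
From mathcomp Require Import all_classical all_reals all_analysis.
Set Implicit Arguments.
Unset Strict Implicit.
Unset Printing Implicit Defensive.
Import Order.TTheory GRing.Theory Num.Theory.
Import numFieldNormedType.Exports.
Local Open Scope classical_set_scope.
Local Open Scope ring_scope.
Local Open Scope complex_scope.

HB.instance Definition _ (R : realType) := NormedModule.copy R[i] R[i]^o.

(* The library norm of a normed space over R[i] takes its (real) values in
   R[i]; rnorm is the same norm with values in R. *)
Definition rnorm (R : realType) (V : normedModType R[i]) (v : V) : R :=
  complex.Re `|v|.

Section rnorm.
Context {R : realType} {V : normedModType R[i]}.
Implicit Types u v : V.

Lemma rnormE v : (rnorm v)%:C = `|v|.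
Proof. by rewrite /rnorm RRe_real ?normr_real. Qed.

Lemma rnorm_ge0 v : 0 <= rnorm v.
Proof. by rewrite -lecR rnormE normr_ge0. Qed.

Lemma rnormD u v : rnorm (u + v) <= rnorm u + rnorm v.
Proof. by rewrite -lecR rmorphD/= !rnormE ler_normD. Qed.

Lemma rnormZ (a : R[i]) v : rnorm (a *: v) = complex.Re `|a| * rnorm v.
Proof.
apply: (@complexI R); rewrite rnormE normrZ.
have -> : (complex.Re `|a| * rnorm v)%:C = (complex.Re `|a|)%:C * (rnorm v)%:C.
  exact: rmorphM.
by rewrite rnormE RRe_real ?normr_real.
Qed.

Lemma rnorm_eq0 v : rnorm v = 0 -> v = 0.
Proof. by move=> v0; apply/normr0_eq0; rewrite -rnormE v0. Qed.

Lemma rnormN v : rnorm (- v) = rnorm v.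
Proof. by rewrite /rnorm normrN. Qed.

Lemma rnorm_dist u v : `|rnorm u - rnorm v| <= rnorm (u - v).
Proof.
have H (a b : V) : rnorm a <= rnorm b + rnorm (a - b).
  by have := rnormD (a - b) b; rewrite subrK addrC.
rewrite ler_distl H andbT lerBlDr.
by have := H v u; rewrite -[v - u]opprB rnormN.
Qed.

Lemma rnorm_continuous : continuous (@rnorm R V).
Proof.
move=> v; apply/cvgrPdist_le => e e0.
have e0' : (0 : R[i]) < e%:C by rewrite ltcR.
near=> w.
apply: le_trans (rnorm_dist _ _) _.
rewrite -lecR rnormE; near: w.
by apply: (@cvgr_dist_le _ _ _ (nbhs v) _ id v) e0'; exact: cvg_id.
Unshelve. all: by end_near. Qed.

End rnorm.

Section continuousType_lmod.
Context {R : realType} {T : topologicalType}.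
Local Notation X := (continuousType T R[i]).
Implicit Types f g : X.

Let cf f : continuous f. Proof. exact: cts_fun. Qed.

Let opp_cts f : continuous (fun x => - f x).
Proof. by move=> x; apply: continuousN; exact: cf. Qed.
Let add_cts f g : continuous (fun x => f x + g x).
Proof. by move=> x; apply: continuousD; exact: cf. Qed.
Let scale_cts (a : R[i]) f : continuous (fun x => a *: f x).
Proof. by move=> x; apply: continuousZl_tmp; exact: cf. Qed.

Let zero : X := cst 0.
Let opp f : X := mkcts (@opp_cts f).
Let add f g : X := mkcts (@add_cts f g).
Let scale (a : R[i]) f : X := mkcts (@scale_cts a f).

Let addA : associative add.
Proof. by move=> f g h; apply/continuousEP => x /=; exact: addrA. Qed.
Let addC : commutative add.
Proof. by move=> f g; apply/continuousEP => x /=; exact: addrC. Qed.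
Let add0 : left_id zero add.
Proof. by move=> f; apply/continuousEP => x /=; exact: add0r. Qed.
Let addN : left_inverse zero opp add.
Proof. by move=> f; apply/continuousEP => x /=; exact: addNr. Qed.

HB.instance Definition _ := GRing.isZmodule.Build X addA addC add0 addN.

Let scaleA a b f : scale a (scale b f) = scale (a * b) f.
Proof. by apply/continuousEP => x /=; exact: scalerA. Qed.
Let scale1 : left_id 1 scale.
Proof. by move=> f; apply/continuousEP => x /=; exact: scale1r. Qed.
Let scaleDr : right_distributive scale +%R.
Proof. by move=> a f g; apply/continuousEP => x /=; exact: scalerDr. Qed.
Let scaleDl f : {morph scale^~ f : a b / a + b}.
Proof. by move=> a b; apply/continuousEP => x /=; exact: scalerDl. Qed.

HB.instance Definition _ :=
  GRing.Zmodule_isLmodule.Build R[i] X scaleA scale1 scaleDr scaleDl.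

End continuousType_lmod.

Record bounded_domain (R : realType) (d : nat) := BoundedDomain {
  domain :> set 'rV[R]_d ;
  domain_open : open domain ;
  domain_connected : connected domain ;
  domain_neq0 : domain !=set0 ;
  domain_bounded : bounded_set domain }.

(* The Banach space of continuous complex-valued functions on the closure of
   a bounded domain, with the maximum norm. *)
Definition Cbar (R : realType) (d : nat) (O : bounded_domain R d) : Type :=
  continuousType (closure O) R[i].

HB.instance Definition _ (R : realType) (d : nat) (O : bounded_domain R d) :=
  GRing.Lmodule.on (Cbar O).

Section Cbar_normed.
Context {R : realType} {d : nat} {O : bounded_domain R d}.
Implicit Types (f g : Cbar O) (x : closure O).

Definition max_norm f : R := sup [set rnorm (f x) | x in [set: closure O]].

Let closure_compact : compact (closure O).
Proof.
apply: bounded_closed_compact; last exact: closed_closure.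
have [M [Mr HM]] := domain_bounded O.
exists M; split=> // y My x.
suff : closure O `<=` [set x | `|x| <= y] by move/[apply].
have : closed [set x : 'rV[R]_d | `|x| <= y].
  have -> : [set x : 'rV[R]_d | `|x| <= y] = Num.norm @^-1` [set z | z <= y].
    by [].
  by apply: closed_comp; [move=> *; exact: norm_continuous|exact: closed_le].
move=> /closure_id ->; apply: closure_subset => z Oz; exact: HM.
Qed.

Let norm_has_ub f : has_ubound [set rnorm (f x) | x in [set: closure O]].
Proof.
pose F : 'rV[R]_d -> R := valL_ 0 (fun x => rnorm (f x)).
have cF : {within closure O, continuous F}.
  apply/subspace_valL_continuousP' => x.
  by apply: continuous_comp; [exact: cts_fun|exact: rnorm_continuous].
have /compact_bounded [M [_ HM]] := continuous_compact cF closure_compact.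
exists (M + 1) => _ [x _ <-].
have := HM (M + 1); rewrite ltrDl => /(_ ltr01 (F (set_val x))) H.
have FE : F (set_val x) = rnorm (f x).
  exact: (congr1 (fun h => h x) (valLK 0 (fun x => rnorm (f x)))).
rewrite -FE (le_trans (ler_norm _))// H//.
by exists (set_val x) => //; exact: set_valP.
Qed.

Let x0 : closure O.
Proof.
have /cid[x Ox] := domain_neq0 O.
by exists x; apply/mem_set/subset_closure.
Qed.

Let norm_le f x : rnorm (f x) <= max_norm f.
Proof. by apply: ub_le_sup => //; exists x. Qed.

Let le_norm f (M : R) : (forall x, rnorm (f x) <= M) -> max_norm f <= M.
Proof.
move=> H; apply: ge_sup; first by exists (rnorm (f x0)), x0.
by move=> _ [x _ <-].
Qed.

Let normD f g : (max_norm (f + g))%:C <= (max_norm f)%:C + (max_norm g)%:C.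
Proof.
rewrite -rmorphD lecR; apply: le_norm => x.
by apply: le_trans (rnormD _ _) _; apply: lerD; exact: norm_le.
Qed.

Let normZ (a : R[i]) f : (max_norm (a *: f))%:C = `|a| * (max_norm f)%:C.
Proof.
have le b g : max_norm (b *: g) <= complex.Re `|b| * max_norm g.
  apply: le_norm => x; have -> : (b *: g) x = b *: (g x) by [].
  by rewrite rnormZ ler_wpM2l ?norm_le//; exact: (@rnorm_ge0 R R[i]).
suff -> : max_norm (a *: f) = complex.Re `|a| * max_norm f.
  transitivity ((complex.Re `|a|)%:C * (max_norm f)%:C); first exact: rmorphM.
  by congr (_ * _); apply: RRe_real; exact: normr_real.
apply/eqP; rewrite eq_le le andTb.
have [a0|a0] := eqVneq a 0.
  have -> : complex.Re `|a| = 0.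
    by apply: (@complexI R); rewrite RRe_real ?normr_real// a0 normr0.
  rewrite mul0r.
  by apply: le_trans (norm_le _ x0); exact: (@rnorm_ge0 R R[i]).
rewrite -[X in _ * max_norm X](scalerK a0) -[leRHS]mul1r.
have a_ge0 (b : R[i]) : 0 <= complex.Re `|b| by exact: (@rnorm_ge0 R R[i]).
rewrite (_ : 1 = complex.Re `|a| * complex.Re `|a^-1|).
  by rewrite -mulrA ler_wpM2l.
have := @rnormZ R R[i] a a^-1; rewrite /rnorm => <-.
by rewrite [_ *: _]divff// normr1.
Qed.

Let norm0 f : (max_norm f)%:C = 0 -> f = 0.
Proof.
move=> /complexI f0; apply/continuousEP => x; apply: (@rnorm_eq0 R R[i]).
by apply/eqP; rewrite eq_le rnorm_ge0 andbT -f0 norm_le.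
Qed.

HB.instance Definition _ :=
  Lmodule_isNormed.Build R[i] (Cbar O) normD normZ norm0.

End Cbar_normed.
(* Operator norm of a bounded map, linear over R or over R[i]. *)
Definition opnorm (R : realType) (V W : normedModType R[i]) (L : V -> W) : R :=
  sup [set rnorm (L v) | v in [set v | rnorm v <= 1]].

(* The operator norm induced by the maximum norm of column vectors; the
   library norm of a matrix is instead the maximum modulus of its entries. *)
Definition mxopnorm (R : realType) (N : nat) (M : 'M[R[i]]_N) : R :=
  opnorm (mulmx M : 'cV[R[i]]_N -> 'cV[R[i]]_N).

Definition expmx (R : realType) (N : nat) (M : 'M[R[i]]_N) : 'M[R[i]]_N :=
  limn (fun m => \sum_(j < m) (j`!%:R : R[i])^-1 *: M ^+ j).

Definition subspace_of (R : realType) (V : lmodType R[i]) (D : set V) : Prop :=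
  D 0 /\ forall (a : R[i]) x y, D x -> D y -> D (a *: x + y).

Definition linear_on (R : realType) (V W : lmodType R[i]) (D : set V)
    (L : V -> W) : Prop :=
  forall (a : R[i]) x y, D x -> D y -> L (a *: x + y) = a *: L x + L y.

Definition norm_on (R : realType) (V : lmodType R[i]) (D : set V)
    (nm : V -> R) : Prop :=
  [/\ forall x, D x -> 0 <= nm x,
      forall x, D x -> nm x = 0 -> x = 0,
      forall (a : R[i]) x, D x -> nm (a *: x) = complex.Re `|a| * nm x &
      forall x y, D x -> D y -> nm (x + y) <= nm x + nm y].

(* Derivatives with respect to the real variable on [0, T], one-sided at the
   end points. *)
Definition derivative_on (R : realType) (V : normedModType R[i]) (T : R)
    (g g' : R -> V) : Prop :=
  forall t : R, 0 <= t <= T ->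
    (fun s => ((s - t)^-1)%:C *: (g s - g t)) @ within `[0, T] t^' --> g' t.

Definition C1_on (R : realType) (V : normedModType R[i]) (T : R)
    (g : R -> V) : Prop :=
  exists2 g', derivative_on T g g' & {within `[0, T], continuous g'}.

Definition C2_on (R : realType) (V : normedModType R[i]) (T : R)
    (g : R -> V) : Prop :=
  exists2 g', derivative_on T g g' & C1_on T g'.

Definition strip (R : realType) (V : Type) (T : R) : set (R * V) :=
  [set p | 0 <= p.1 <= T].

(* f is continuously Frechet differentiable on [0, T] x V, with partial
   derivatives ft and fv. The differential is only required to be R-linear:
   f need not be holomorphic in its second variable. *)
Definition C1_with (R : realType) (V W : normedModType R[i]) (T : R)
    (f ft : R -> V -> W) (fv : R -> V -> V -> W) : Prop :=
  [/\ forall (t : R) x, 0 <= t <= T ->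
        (forall (a : R) v w,
          fv t x (a%:C *: v + w) = a%:C *: fv t x v + fv t x w) /\
        continuous (fv t x),
      forall (t : R) x, 0 <= t <= T ->
        (fun p => rnorm (f p.1 p.2 - f t x -
                         ((p.1 - t)%:C *: ft t x + fv t x (p.2 - x))) /
                  (`|p.1 - t| + rnorm (p.2 - x)))
          @ within (strip T) (nbhs (t, x)) --> (0 : R),
      {within (strip T), continuous (fun p => ft p.1 p.2)} &
      forall (t : R) x, 0 <= t <= T ->
        (fun p => opnorm (fun v => fv p.1 p.2 v - fv t x v))
          @ within (strip T) (nbhs (t, x)) --> (0 : R)].

Definition C1_strip (R : realType) (V W : normedModType R[i]) (T : R)
    (f : R -> V -> W) : Prop :=
  exists ft fv, C1_with T f ft fv.

Definition C0_semigroup (R : realType) (V : normedModType R[i])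
    (S : R -> V -> V) : Prop :=
  [/\ forall t : R, 0 <= t -> linear (S t) /\ continuous (S t),
      forall x, S 0 x = x,
      forall (s t : R) x, 0 <= s -> 0 <= t -> S (s + t) x = S s (S t x) &
      forall x, S t x @[t --> 0^'+] --> x].

(* The operator A, restricted to D, is the infinitesimal generator of S. *)
Definition generates (R : realType) (V : normedModType R[i]) (D : set V)
    (A : V -> V) (S : R -> V -> V) : Prop :=
  forall x y, (D x /\ A x = y) <->
    (t^-1)%:C *: (S t x - x) @[t --> 0^'+] --> y.

(* The type of a semigroup; it may be -oo. *)
Definition growth_bound (R : realType) (V : normedModType R[i])
    (S : R -> V -> V) : \bar R :=
  ereal_inf [set w%:E | w in [set w : R | exists M : R, forall (t : R) x,
    0 <= t -> rnorm (S t x) <= M * expR (w * t) * rnorm x]].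

(* The problem u' = A u + f(t, u), u(0) = u0, bdry u = g on [0, T]. Only the
   values of f and g at times in [0, T], and those of A and bdry on domA, are
   meaningful; sgrp is the semigroup generated by the restriction of A to the
   kernel of bdry. *)
Record ibvp (R : realType) (d : nat) (O : bounded_domain R d)
    (Y : completeNormedModType R[i]) := Ibvp {
  Tend : R ;
  domA : set (Cbar O) ;
  opA : Cbar O -> Cbar O ;
  bdry : Cbar O -> Y ;
  source : R -> Cbar O -> Cbar O ;
  bdata : R -> Y ;
  init : Cbar O ;
  sol : R -> Cbar O ;
  sgrp : R -> Cbar O -> Cbar O }.

Definition kerbdry (R : realType) (d : nat) (O : bounded_domain R d)
    (Y : completeNormedModType R[i]) (P : ibvp O Y) : set (Cbar O) :=
  [set x | domA P x /\ bdry P x = 0].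

Record is_solution (R : realType) (d : nat) (O : bounded_domain R d)
    (Y : completeNormedModType R[i]) (P : ibvp O Y) : Prop := IsSolution {
  sol_domain : forall t : R, 0 <= t <= Tend P -> domA P (sol P t) ;
  sol_eq : derivative_on (Tend P) (sol P)
    (fun t => opA P (sol P t) + source P t (sol P t)) ;
  sol_init : sol P 0 = init P ;
  sol_bdry : forall t : R, 0 <= t <= Tend P -> bdry P (sol P t) = bdata P t }.

Record continuous_hyps (R : realType) (d : nat) (O : bounded_domain R d)
    (Y : completeNormedModType R[i]) (P : ibvp O Y) : Prop := ContinuousHyps {
  Tend_gt0 : 0 < Tend P ;
  domA_subspace : subspace_of (domA P) ;
  opA_linear : linear_on (domA P) (opA P) ;
  bdry_linear : linear_on (domA P) (bdry P) ;
  bdry_onto : forall y, exists2 x, domA P x & bdry P x = y ;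
  bdata_C1 : C1_on (Tend P) (bdata P) ;
  kerbdry_dense : dense (kerbdry P) ;
  sgrp_C0 : C0_semigroup (sgrp P) ;
  sgrp_gen : generates (kerbdry P) (opA P) (sgrp P) ;
  sgrp_type : (growth_bound (sgrp P) < 0)%E ;
  elliptic_wp : forall (z : R[i]) (v : Y), 0 < complex.Re z ->
    exists! x, [/\ domA P x, opA P x = z *: x & bdry P x = v] ;
  elliptic_bound : exists w0 C : R, (growth_bound (sgrp P) < w0%:E)%E /\
    forall (z : R[i]) (v : Y) x, w0 <= complex.Re z ->
      domA P x -> opA P x = z *: x -> bdry P x = v -> rnorm x <= C * rnorm v ;
  source_C1 : C1_strip (Tend P) (source P) ;
  sol_solution : is_solution P ;
  sol_C1 : C1_on (Tend P) (sol P) ;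
  opA_sol_continuous :
    {within `[0, Tend P], continuous (fun t => opA P (sol P t))} }.

(* A family of discretizations, indexed by the admissible mesh parameters. *)
Record discretization (R : realType) (d : nat) (O : bounded_domain R d)
    (Y : completeNormedModType R[i]) := Discretization {
  mesh : set R ;
  nodes : R -> nat ;
  grid : forall h, 'I_(nodes h) -> closure O ;
  Ah : forall h, 'M[R[i]]_(nodes h) ;
  Ch : forall h, {linear Y -> 'cV[R[i]]_(nodes h)} ;
  fh : forall h, R -> 'cV[R[i]]_(nodes h) -> 'cV[R[i]]_(nodes h) }.

Arguments grid {R d O Y} _ _ _.
Arguments fh {R d O Y} _ _ _ _.

Definition Ph (R : realType) (d : nat) (O : bounded_domain R d)
    (Y : completeNormedModType R[i]) (D : discretization O Y) (h : R)
    (v : Cbar O) : 'cV[R[i]]_(nodes D h) :=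
  \col_i v (grid D h i).

(* The solution r of Ah r + Ch (bdry v) = Ph (A v). *)
Definition Rh (R : realType) (d : nat) (O : bounded_domain R d)
    (Y : completeNormedModType R[i]) (P : ibvp O Y) (D : discretization O Y)
    (h : R) (v : Cbar O) : 'cV[R[i]]_(nodes D h) :=
  invmx (Ah D h) *m (Ph D h (opA P v) - Ch D h (bdry P v)).

(* The subspace Z with norm Znorm, and the consistency errors eps and eta. *)
Record consistency_space (R : realType) (d : nat) (O : bounded_domain R d)
    (Y : completeNormedModType R[i]) (P : ibvp O Y) (D : discretization O Y)
    (Z : set (Cbar O)) (Znorm : Cbar O -> R) (eps eta : R -> R) : Prop :=
  ConsistencySpace {
  Z_domain : Z `<=` domA P ;
  Z_subspace : subspace_of Z ;
  Z_norm : norm_on Z Znorm ;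
  Z_inv : forall v, Z v ->
    exists x, [/\ kerbdry P x, opA P x = v & Z x] ;
  Z_sgrp : forall (t : R) v, 0 <= t <= Tend P -> Z v -> Z (sgrp P t v) ;
  Z_source : forall (t : R) v, 0 <= t <= Tend P -> Z v -> Z (source P t v) ;
  Z_eps : forall h v, mesh D h -> Z v ->
    rnorm (Ah D h *m (Ph D h v - Rh P D h v)) <= eps h * Znorm v ;
  Z_eta : forall h v, mesh D h -> Z v ->
    rnorm (Ph D h v - Rh P D h v) <= eta h * Znorm v ;
  eps_small : eps h @[h --> within (mesh D) 0^'] --> (0 : R) ;
  eta_small : eta h @[h --> within (mesh D) 0^'] --> (0 : R) }.

Record discretization_hyps (R : realType) (d : nat) (O : bounded_domain R d)
    (Y : completeNormedModType R[i]) (P : ibvp O Y) (D : discretization O Y)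
    : Prop := DiscretizationHyps {
  mesh_gt0 : forall h, mesh D h -> 0 < h ;
  grid_inj : forall h, mesh D h -> injective (grid D h) ;
  Ah_contraction : forall h (t : R), mesh D h -> 0 <= t ->
    mxopnorm (expmx (t%:C *: Ah D h)) <= 1 ;
  Ah_unit : forall h, mesh D h -> Ah D h \in unitmx ;
  Ah_inv_bound : exists C : R, forall h, mesh D h ->
    mxopnorm (invmx (Ah D h)) <= C ;
  Ch_bounded : forall h, mesh D h -> continuous (Ch D h) ;
  consistency : exists Z Znorm eps eta, consistency_space P D Z Znorm eps eta ;
  AhCh_bound : exists C : R, forall h, mesh D h ->
    opnorm (fun y => invmx (Ah D h) *m Ch D h y) <= C ;
  fh_compat : forall h (t : R) v, mesh D h -> 0 <= t <= Tend P ->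
    Ph D h (source P t v) = fh D h t (Ph D h v) ;
  fh_C1 : forall h, mesh D h -> C1_strip (Tend P) (fh D h) }.

(* Coefficients of an s-stage explicit Runge-Kutta tableau; the entries
   rk_a i j with i <= j are never used. *)
Record tableau (R : realType) (s : nat) := Tableau {
  rk_a : 'I_s -> 'I_s -> R ;
  rk_b : 'I_s -> R ;
  rk_c : 'I_s -> R ;
  rk_c_itv : forall i, 0 <= rk_c i <= 1 }.

(* The sequences U (approximations) and K (stages) are the ones produced by
   the classical Lawson method with stepsize k on the grid of parameter h, up
   to the final time. *)
Record lawson (R : realType) (d : nat) (O : bounded_domain R d)
    (Y : completeNormedModType R[i]) (P : ibvp O Y) (D : discretization O Y)
    (s : nat) (rk : tableau R s) (h k : R)
    (U : nat -> 'cV[R[i]]_(nodes D h))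
    (K : nat -> 'I_s -> 'cV[R[i]]_(nodes D h)) : Prop := Lawson {
  lawson_init : U 0 = Ph D h (sol P 0) ;
  lawson_stage : forall n i, n.+1%:R * k <= Tend P ->
    K n i = expmx ((rk_c rk i * k)%:C *: Ah D h) *m U n +
      k%:C *: \sum_(j < s | (j < i)%N) (rk_a rk i j)%:C *:
        (expmx (((rk_c rk i - rk_c rk j) * k)%:C *: Ah D h) *m
          (Ch D h (bdata P (n%:R * k + rk_c rk j * k)) +
           fh D h (n%:R * k + rk_c rk j * k) (K n j))) ;
  lawson_step : forall n, n.+1%:R * k <= Tend P ->
    U n.+1 = expmx (k%:C *: Ah D h) *m U n +
      k%:C *: \sum_(i < s) (rk_b rk i)%:C *:
        (expmx (((1 - rk_c rk i) * k)%:C *: Ah D h) *m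
          (Ch D h (bdata P (n%:R * k + rk_c rk i * k)) +
           fh D h (n%:R * k + rk_c rk i * k) (K n i))) }.

(* The derivative of fh with respect to its second variable is bounded,
   uniformly in h and k, on tubes around the exact solution that contain the
   numerical approximations. The radius r may depend on h and k: with a fixed
   radius the numerical error would be bounded by hypothesis. *)
Definition fh_derivative_bounded (R : realType) (d : nat)
    (O : bounded_domain R d) (Y : completeNormedModType R[i]) (P : ibvp O Y)
    (D : discretization O Y) (s : nat) (rk : tableau R s)
    (U : forall h, R -> nat -> 'cV[R[i]]_(nodes D h))
    (K : forall h, R -> nat -> 'I_s -> 'cV[R[i]]_(nodes D h)) : Prop :=
  exists L : R, forall h, mesh D h ->
    exists ft fv, C1_with (Tend P) (fh D h) ft fv /\
      forall k : R, 0 < k <= Tend P -> exists r : R,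
        [/\ 0 < r,
            forall n, n%:R * k <= Tend P ->
              rnorm (U h k n - Ph D h (sol P (n%:R * k))) < r,
            forall n i, n.+1%:R * k <= Tend P ->
              rnorm (K h k n i -
                Ph D h (sol P (n%:R * k + rk_c rk i * k))) < r &
            forall (t : R) V, 0 <= t <= Tend P ->
              rnorm (V - Ph D h (sol P t)) < r -> opnorm (fv t V) <= L].

(* Main.v *)
(** Since the exact solution is bounded, it suffices to bound U_h^n. Unrolling
    the recurrence, U_h^n is a sum of the terms e^(rkA) applied to the
    contributions of the n steps, with A = A_(h,0). The contributions of f are
    affine in the norms of the stages, hence, by the tableau being explicit, in
    1 + k ||C_h|| + ||U_h^m||. Those of C_h g are written A (A^-1 C_h g): as
    A^-1 C_h is bounded uniformly in h and g is Lipschitz in time, a summation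
    by parts leaves only partial sums of k A e^(rkA), which are bounded by
    hypothesis; the term r = 0, where no sum is available, is at most a multiple
    of k ||C_h||. The discrete Gronwall inequality concludes. *)
Require Import Defs.
From mathcomp Require Import all_boot all_order all_algebra.
From mathcomp Require Import ring lra.
From mathcomp Require Import complex.
From mathcomp Require Import all_classical all_reals all_analysis.
Set Implicit Arguments.
Unset Strict Implicit.
Unset Printing Implicit Defensive.
Import Order.TTheory GRing.Theory Num.Theory.
Import numFieldNormedType.Exports.
Local Open Scope classical_set_scope.
Local Open Scope ring_scope.
Local Open Scope complex_scope.

(** * Real-valued norms of vectors and matrices *)

Section rnorm_extra.
Context {R : realType}.
Implicit Type V W : normedModType R[i].

Lemma rnorm0 V : rnorm (0 : V) = 0.
Proof. by rewrite /rnorm normr0. Qed.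

Lemma rnorm_sum V (I : Type) (r : seq I) (Q : pred I) (F : I -> V) :
  rnorm (\sum_(i <- r | Q i) F i) <= \sum_(i <- r | Q i) rnorm (F i).
Proof.
elim/big_ind2 : _ => [|x a y b xa yb|//]; first by rewrite rnorm0.
exact: le_trans (rnormD _ _) (lerD _ _).
Qed.

Lemma Re_norm_real (a : R) : complex.Re `|a%:C| = `|a|.
Proof. by rewrite normc_def /= expr0n addr0 sqrtr_sqr. Qed.

Lemma rnormZr V (a : R) (v : V) : rnorm (a%:C *: v) = `|a| * rnorm v.
Proof. by rewrite rnormZ Re_norm_real. Qed.

Lemma rnormM (a b : R[i]) : @rnorm R R[i] (a * b) = rnorm (a : R[i]) * rnorm (b : R[i]).
Proof. exact: (@rnormZ R R[i] a b). Qed.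

Lemma norm_Re_le (z : R[i]) : `|complex.Re z| <= @rnorm R R[i] z.
Proof. by rewrite -lecR rnormE; exact: normc_ge_Re. Qed.

Lemma norm_Im_le (z : R[i]) : `|complex.Im z| <= @rnorm R R[i] z.
Proof.
rewrite /rnorm normc_def /= -sqrtr_sqr ler_wsqrtr// lerDr.
exact: sqr_ge0.
Qed.

Lemma rnorm_le_ReIm (z : R[i]) :
  @rnorm R R[i] z <= `|complex.Re z| + `|complex.Im z|.
Proof.
rewrite /rnorm normc_def /= -[leRHS]ger0_norm ?addr_ge0// -sqrtr_sqr.
rewrite ler_wsqrtr// sqrrD !real_normK ?num_real// addrAC lerDl.
by rewrite mulrn_wge0// mulr_ge0.
Qed.

Lemma rnorm_cvg V (u : nat -> V) (l : V) :
  rnorm (u n - l) @[n --> \oo] --> (0 : R) -> u n @[n --> \oo] --> l.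
Proof.
move=> /cvgr0Pnorm_le ul; apply/cvgrPdistC_le => e e0.
have e_real : (complex.Re e)%:C = e by rewrite RRe_real// gtr0_real.
have Re_gt0 : 0 < complex.Re e by rewrite -ltcR e_real.
near=> n; rewrite -rnormE -e_real lecR -[leLHS]ger0_norm ?rnorm_ge0//.
by near: n; exact: ul.
Unshelve. all: by end_near. Qed.

End rnorm_extra.

Section matrix_rnorm.
Context {R : realType}.

Lemma rnorm_entry_le m n (M : 'M[R[i]]_(m, n)) i j :
  @rnorm R R[i] (M i j) <= rnorm M.
Proof.
rewrite -lecR !rnormE [leRHS]/Num.Def.normr /= mx_normE -[leLHS]nngE num_le.
exact: (le_bigmax _ _ (i, j)).
Qed.

Lemma rnorm_mx_le m n (M : 'M[R[i]]_(m, n)) (c : R) : 0 <= c ->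
  (forall i j, @rnorm R R[i] (M i j) <= c) -> rnorm M <= c.
Proof.
move=> c0 Mc; have [M0|/mx_norm_neq0 [[i j] /= Mij]] := eqVneq (mx_norm M) 0.
  by rewrite /rnorm [`|M|]M0.
by rewrite /rnorm [`|M|]Mij Mc.
Qed.

(** The largest-entry norm is not submultiplicative: the factor [n] counts the products summed in
    one entry of [A *m B]. *)
Lemma rnorm_mulmx_le m n p (A : 'M[R[i]]_(m, n)) (B : 'M[R[i]]_(n, p)) :
  rnorm (A *m B) <= n%:R * rnorm A * rnorm B.
Proof.
apply: rnorm_mx_le; first by rewrite !mulr_ge0 ?rnorm_ge0.
move=> i j; rewrite mxE (le_trans (rnorm_sum _ _ _))//.
rewrite (@le_trans _ _ (\sum_(k < n) rnorm A * rnorm B))//; last first.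
  by rewrite sumr_const card_ord -mulrA mulr_natl.
apply: ler_sum => k _; rewrite rnormM.
by rewrite ler_pM ?rnorm_ge0 ?rnorm_entry_le.
Qed.

End matrix_rnorm.

(** * Operator norms of bounded maps *)

Section opnorm_theory.
Context {R : realType}.
Implicit Type V W : normedModType R[i].

Lemma has_ubound_opnorm V W (L : V -> W) (M : R) :
  (forall v, rnorm (L v) <= M * rnorm v) ->
  has_ubound [set rnorm (L v) | v in [set v | rnorm v <= 1]].
Proof.
move=> LM; exists `|M| => _ [v /= v1 <-].
rewrite (le_trans (LM v))// (le_trans (ler_norm _))// normrM.
by rewrite ler_piMr// ger0_norm ?rnorm_ge0.
Qed.

Lemma opnorm_ge0 V W (L : V -> W) (M : R) : L 0 = 0 ->
  (forall v, rnorm (L v) <= M * rnorm v) -> 0 <= opnorm L.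
Proof.
move=> L0 LM; apply: ub_le_sup; first exact: has_ubound_opnorm LM.
by exists 0 => /=; rewrite ?L0 rnorm0.
Qed.

(** Rescale [v] to unit norm. The bound by [M] makes the supremum a genuine one, since [sup] of an
    unbounded set is 0. Homogeneity is real because the Frechet derivatives are merely R-linear. *)
Lemma ler_opnorm V W (L : V -> W) (M : R) :
  (forall (a : R) v, L (a%:C *: v) = a%:C *: L v) ->
  (forall v, rnorm (L v) <= M * rnorm v) ->
  forall v, rnorm (L v) <= opnorm L * rnorm v.
Proof.
move=> LZ LM v; have [v0|v0] := eqVneq (rnorm v) 0.
  by rewrite (le_trans (LM v))// v0 !mulr0.
have v_gt0 : 0 < rnorm v by rewrite lt0r v0 rnorm_ge0.
rewrite -ler_pdivrMr// mulrC -[X in X * _]gtr0_norm ?invr_gt0//.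
rewrite -rnormZr -LZ; apply: ub_le_sup; first exact: has_ubound_opnorm LM.
exists ((rnorm v)^-1%:C *: v) => //=.
by rewrite rnormZr gtr0_norm ?invr_gt0// mulVf.
Qed.

Lemma continuous_bounded V W (L : V -> W) :
  (forall (a : R) v, L (a%:C *: v) = a%:C *: L v) -> {for 0, continuous L} ->
  exists M : R, forall v, rnorm (L v) <= M * rnorm v.
Proof.
move=> LZ L0; have L00 : L 0 = 0.
  by rewrite -[in LHS](scale0r (0 : V)) (LZ 0 0) scale0r.
have := L0 => /cvgrPdistC_le /(_ 1 ltr01).
rewrite L00 => /nbhs_norm0P [e /= e0 He].
have e_real : (complex.Re e)%:C = e by rewrite RRe_real// gtr0_real.
set d := complex.Re e in e_real.
have d0 : 0 < d by rewrite -ltcR e_real.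
exists (2 / d) => v; have [v0|v0] := eqVneq (rnorm v) 0.
  by rewrite (rnorm_eq0 v0) L00 !rnorm0 mulr0.
have v_gt0 : 0 < rnorm v by rewrite lt0r v0 rnorm_ge0.
(* This factor scales [v] to norm [d / 2], inside the ball where [L] has norm at most 1; hence the
   constant [2 / d]. *)
pose a := d / (2 * rnorm v).
have a0 : 0 < a by rewrite divr_gt0// mulr_gt0.
have /He /= : `|a%:C *: v| < e.
  rewrite -rnormE -e_real ltcR rnormZr gtr0_norm// /a invfM mulrA divfK//.
  by rewrite ltr_pdivrMr// ltr_pMr// ltr1n.
rewrite subr0 -rnormE (_ : 1 = (1 : R)%:C) // lecR LZ rnormZr gtr0_norm//.
by rewrite /a mulrC -ler_pdivlMr// invf_div mul1r mulrAC.
Qed.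

Lemma ler_opnorm_continuous V W (L : V -> W) :
  (forall (a : R) v, L (a%:C *: v) = a%:C *: L v) -> {for 0, continuous L} ->
  forall v, rnorm (L v) <= opnorm L * rnorm v.
Proof. by move=> LZ /(continuous_bounded LZ)[M]; exact: ler_opnorm. Qed.

Lemma ler_mxopnorm N (M : 'M[R[i]]_N) (v : 'cV[R[i]]_N) :
  rnorm (M *m v) <= mxopnorm M * rnorm v.
Proof.
apply: (ler_opnorm _ (rnorm_mulmx_le M)) => a w.
by rewrite -scalemxAr.
Qed.

End opnorm_theory.

(** * The matrix exponential: convergence and functional equation *)

Section dominated_cvg.
Context {R : realType}.
Variable t : R ^nat.
Hypothesis t_cvg : cvgn t.

(** The domination makes [t] and [x + t] nondecreasing and bounded, so [x] converges as their
    difference; the rate follows by letting [q] tend to infinity. *)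
Lemma dominated_real_cvg (x : R ^nat) :
  (forall p q, (p <= q)%N -> `|x q - x p| <= t q - t p) ->
  exists l : R, forall n, `|x n - l| <= limn t - t n.
Proof.
move=> xt.
have t_nd : {homo t : p q / (p <= q)%N >-> p <= q}.
  by move=> p q /xt /(le_trans (normr_ge0 _)); rewrite subr_ge0.
have t_le n : t n <= limn t by exact: nondecreasing_cvgn_le.
have x_cvg : cvgn x.
  rewrite (_ : x = (x \+ t) \- t); last by apply/funext => n /=; rewrite addrK.
  apply: is_cvgB => //; apply: nondecreasing_is_cvgn => [p q pq /=|].
    by have /ler_normlP[] := xt p q pq; lra.
  exists (x 0 - t 0 + limn t + limn t) => _ [n _ <-] /=.
  by have /ler_normlP[] := xt 0 n isT; have := t_le n; lra.
exists (limn x) => n; rewrite distrC.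
have x_lim : `|x q - x n| @[q --> \oo] --> `|limn x - x n|.
  by apply: cvg_norm; apply: cvgB => //; exact: cvg_cst.
have t_lim : t q - t n @[q --> \oo] --> limn t - t n.
  by apply: cvgB => //; exact: cvg_cst.
apply: (ler_cvg_to x_lim t_lim).
by near=> q; apply: xt; near: q; exact: nbhs_infty_ge.
Unshelve. all: by end_near. Qed.

(** The real and imaginary parts of each entry inherit the domination with a rate common to all
    entries; adding the two parts doubles it. *)
Lemma dominated_mx_cvg m n (S : nat -> 'M[R[i]]_(m, n)) :
  (forall p q, (p <= q)%N -> rnorm (S q - S p) <= t q - t p) ->
  exists E, rnorm (S k - E) @[k --> \oo] --> (0 : R).
Proof.
move=> St.
have Sij p q i j : (p <= q)%N -> @rnorm R R[i] (S q i j - S p i j) <= t q - t p.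
  move=> /St; apply: le_trans.
  by have := rnorm_entry_le (S q - S p) i j; rewrite !mxE.
have Re_cvg i j : exists l : R, forall k,
    `|complex.Re (S k i j) - l| <= limn t - t k.
  apply: dominated_real_cvg => p q pq.
  apply: le_trans (Sij p q i j pq); apply: le_trans (norm_Re_le _).
  by case: (S q i j) (S p i j) => [? ?] [].
have Im_cvg i j : exists l : R, forall k,
    `|complex.Im (S k i j) - l| <= limn t - t k.
  apply: dominated_real_cvg => p q pq.
  apply: le_trans (Sij p q i j pq); apply: le_trans (norm_Im_le _).
  by case: (S q i j) (S p i j) => [? ?] [].
pose re i j := projT1 (cid (Re_cvg i j)); pose im i j := projT1 (cid (Im_cvg i j)).
exists (\matrix_(i, j) Complex (re i j) (im i j)).
have t_le k : t k <= limn t.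
  apply: nondecreasing_cvgn_le => // p q /St /(le_trans (rnorm_ge0 _)).
  by rewrite subr_ge0.
apply: (@squeeze_cvgr _ _ _ _ (fun=> 0) (fun k => (limn t - t k) *+ 2)).
- near=> k; rewrite rnorm_ge0/= rnorm_mx_le ?mulrn_wge0 ?subr_ge0// => i j.
  rewrite !mxE (le_trans (rnorm_le_ReIm _))// mulr2n.
  have := projT2 (cid (Re_cvg i j)) k; have := projT2 (cid (Im_cvg i j)) k.
  by rewrite /re /im; case: (S k i j) => a b /= ? ?; rewrite lerD.
- exact: cvg_cst.
- rewrite -(mul0rn _ 2) -(subrr (limn t)).
  by apply: cvgMn; apply: cvgB => //; exact: cvg_cst.
Unshelve. all: by end_near. Qed.

End dominated_cvg.

Section cauchy_product.

(** The product of two partial sums runs over a square of degrees and the truncated Cauchy product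
    over the triangle [i + j < m]; what remains has total degree at least [m]. *)
Lemma sum_square_sub_triangle (V : zmodType) (F : nat -> nat -> V) m :
  \sum_(i < m) \sum_(j < m) F j i - \sum_(l < m) \sum_(i < l.+1) F (l - i)%N i =
  \sum_(0 <= i < m) \sum_(m - i <= j < m) F j i.
Proof.
have -> : \sum_(l < m) \sum_(i < l.+1) F (l - i)%N i =
    \sum_(0 <= i < m) \sum_(0 <= j < m - i) F j i.
  transitivity
      (\sum_(0 <= l < m) \sum_(0 <= i < m | (i <= l)%N) F (l - i)%N i).
    rewrite big_mkord; apply: eq_bigr => l _.
    rewrite -(big_mkord xpredT (fun i => F (l - i)%N i)).
    by rewrite (big_nat_widen _ _ m)//; apply: eq_bigl => i; rewrite ltnS.
  rewrite (exchange_big_dep_nat xpredT)//=; apply: eq_big_nat => i im.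
  transitivity (\sum_(0 + i <= l < m) F (l - i)%N i).
    by rewrite add0n [RHS](big_nat_widenl _ 0).
  by rewrite big_addn; apply: eq_bigr => j _; rewrite addnK.
rewrite -(big_mkord xpredT (fun i => \sum_(j < m) F j i)) -sumrB.
apply: eq_big_nat => i /andP[_ im].
rewrite -(big_mkord xpredT (fun j => F j i)).
by rewrite (@big_cat_nat _ _ _ (m - i))//= ?leq_subr// addrAC subrr add0r.
Qed.

Lemma factV_binomial (K : numFieldType) l i : (i <= l)%N ->
  (l`!%:R : K)^-1 *+ 'C(l, i) = (l - i)`!%:R^-1 * i`!%:R^-1.
Proof.
move=> il; rewrite -[LHS]mulr_natr -(bin_fact il) !natrM.
have C0 : 'C(l, i)%:R != 0 :> K by rewrite pnatr_eq0 -lt0n bin_gt0.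
by field; rewrite C0 !pnatr_eq0 -!lt0n !fact_gt0.
Qed.

End cauchy_product.

Definition expmx_sum (R : realType) (N : nat) (X : 'M[R[i]]_N) (m : nat) :=
  \sum_(j < m) (j`!%:R : R[i])^-1 *: X ^+ j.

Section expmx_theory.
Context {R : realType} {N : nat}.
Implicit Types X Y : 'M[R[i]]_N.

Let real_expsum (a : R) m := \sum_(j < m) (j`!%:R : R)^-1 * a ^+ j.

Let real_expsum_cvg (a : R) : real_expsum a m @[m --> \oo] --> expR a.
Proof.
have -> : real_expsum a = series (exp_coeff a).
  apply/funext => m; rewrite /real_expsum /series /= big_mkord.
  by apply: eq_bigr => j _; rewrite /exp_coeff /= mulrC.
exact: is_cvg_series_exp_coeff.
Qed.

Let rnorm_fact j X : rnorm ((j`!%:R : R[i])^-1 *: X) = (j`!%:R : R)^-1 * rnorm X.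
Proof.
have -> : (j`!%:R : R[i])^-1 = ((j`!%:R : R)^-1)%:C.
  by rewrite -(rmorph_nat (real_complex R)) fmorphV.
by rewrite rnormZr ger0_norm ?invr_ge0.
Qed.

Lemma rnorm_expmx_le X j : rnorm (X ^+ j) <= (N%:R * rnorm X) ^+ j.
Proof.
elim: j => [|j IH].
  rewrite !expr0; apply: rnorm_mx_le => // i j; rewrite mxE.
  by case: (i == j); rewrite ?mulr1n ?mulr0n /rnorm ?normr1 ?normr0 //= ler01.
rewrite !exprS (le_trans (rnorm_mulmx_le _ _))// ler_wpM2l//.
by rewrite mulr_ge0 ?rnorm_ge0.
Qed.

(** The increments of the partial sums are dominated by those of the real exponential series at
    [N%:R * rnorm X]. Thus the [limn] in [expmx] is a true limit. *)
Lemma expmx_sum_cvg X :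
  rnorm (expmx_sum X m - expmx X) @[m --> \oo] --> (0 : R).
Proof.
pose a := N%:R * rnorm X.
have a_cvg : cvgn (real_expsum a).
  by apply/cvg_ex; exists (expR a); exact: real_expsum_cvg.
have [|E SE] := dominated_mx_cvg a_cvg (S := expmx_sum X).
  move=> p q pq; rewrite /real_expsum /expmx_sum.
  rewrite -!(big_mkord xpredT (fun j => (j`!%:R)^-1 *: X ^+ j)).
  rewrite -!(big_mkord xpredT (fun j => (j`!%:R)^-1 * a ^+ j)).
  rewrite !(@big_cat_nat _ _ _ p 0 q)//= [X in rnorm X]addrAC [leRHS]addrAC !subrr !add0r.
  rewrite (le_trans (rnorm_sum _ _ _))//; apply: ler_sum => j _.
  by rewrite rnorm_fact ler_wpM2l ?invr_ge0// rnorm_expmx_le.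
suff -> : expmx X = E by [].
by apply: cvg_lim; [exact: norm_hausdorff|exact: rnorm_cvg].
Qed.

Lemma expmx_unique X (E : 'M[R[i]]_N) :
  rnorm (expmx_sum X m - E) @[m --> \oo] --> (0 : R) -> expmx X = E.
Proof. by move=> XE; apply: cvg_lim; [exact: norm_hausdorff|exact: rnorm_cvg]. Qed.

Lemma expmx0 : expmx (0 : 'M[R[i]]_N) = 1%:M.
Proof.
apply: expmx_unique; rewrite -cvg_shiftS /=.
rewrite [X in X @ _ --> _](_ : _ = fun=> 0); first exact: cvg_cst.
apply/funext => m; rewrite /expmx_sum big_ord_recl expr0 fact0 invr1 scale1r.
by rewrite big1 ?addr0 ?subrr ?rnorm0// => j _; rewrite exprS mul0r scaler0.
Qed.

(** Every partial sum commutes with [X], so the commutator is that of the remainder, which tends to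
    0. *)
Lemma mulmx_expmxC X Y : X *m Y = Y *m X -> X *m expmx Y = expmx Y *m X.
Proof.
move=> XY; apply/eqP; rewrite -subr_eq0; apply/eqP/rnorm_eq0/eqP.
set d := rnorm _; rewrite eq_le rnorm_ge0 andbT.
have sumC m : X *m expmx_sum Y m = expmx_sum Y m *m X.
  rewrite mulmx_sumr mulmx_suml; apply: eq_bigr => j _.
  by rewrite -scalemxAr -scalemxAl; congr (_ *: _); exact: commrX.
pose b := (N%:R * rnorm X) *+ 2.
have b_cvg : b * rnorm (expmx_sum Y m - expmx Y) @[m --> \oo] --> b * 0.
  by apply: cvgMr; exact: expmx_sum_cvg.
rewrite -[leRHS](mulr0 b); apply: ler_cvg_to (cvg_cst d) b_cvg _.
near=> m; rewrite /d.
have -> : X *m expmx Y - expmx Y *m X =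
    (expmx_sum Y m - expmx Y) *m X - X *m (expmx_sum Y m - expmx Y).
  by rewrite mulmxBl mulmxBr sumC opprB [RHS]addrC subrKA.
rewrite (le_trans (rnormD _ _))// rnormN /b mulr2n mulrDl lerD//.
  by rewrite (le_trans (rnorm_mulmx_le _ _))// mulrAC.
exact: rnorm_mulmx_le.
Unshelve. all: by end_near. Qed.

(* The defect of the product of partial sums consists of the monomials of total
   degree at least m, so it is dominated by the scalar defect at the norms. *)
Let rnorm_expmx_sumM X Y m : X *m Y = Y *m X ->
  rnorm (expmx_sum X m *m expmx_sum Y m - expmx_sum (X + Y) m) <=
  N%:R * (real_expsum (N%:R * rnorm X) m * real_expsum (N%:R * rnorm Y) m -
    real_expsum (N%:R * rnorm X + N%:R * rnorm Y) m).
Proof.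
move=> XY; set a := N%:R * rnorm X; set b := N%:R * rnorm Y.
pose F j i := ((j`!%:R : R[i])^-1 * i`!%:R^-1) *: (X ^+ j *m Y ^+ i).
pose f j i := ((j`!%:R : R)^-1 * i`!%:R^-1) * (a ^+ j * b ^+ i).
have -> : expmx_sum X m *m expmx_sum Y m = \sum_(i < m) \sum_(j < m) F j i.
  rewrite mulmx_sumr; apply: eq_bigr => i _; rewrite mulmx_suml.
  by apply: eq_bigr => j _; rewrite -scalemxAl -scalemxAr scalerA.
have -> : expmx_sum (X + Y) m = \sum_(l < m) \sum_(i < l.+1) F (l - i)%N i.
  apply: eq_bigr => l _; rewrite exprDn_comm// scaler_sumr.
  apply: eq_bigr => i _; rewrite -scalerMnr scalerMnl factV_binomial//.
  by rewrite -ltnS.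
have -> : real_expsum a m * real_expsum b m = \sum_(i < m) \sum_(j < m) f j i.
  rewrite mulr_sumr; apply: eq_bigr => i _; rewrite mulr_suml.
  by apply: eq_bigr => j _; rewrite mulrACA.
have -> : real_expsum (a + b) m = \sum_(l < m) \sum_(i < l.+1) f (l - i)%N i.
  apply: eq_bigr => l _; rewrite exprDn_comm; last exact: mulrC.
  rewrite mulr_sumr; apply: eq_bigr => i _.
  by rewrite mulrnAr -mulrnAl factV_binomial// -ltnS.
rewrite !sum_square_sub_triangle mulr_sumr.
rewrite (le_trans (rnorm_sum _ _ _))//; apply: ler_sum => i _.
rewrite mulr_sumr (le_trans (rnorm_sum _ _ _))//; apply: ler_sum => j _.
rewrite /F -scalerA !rnorm_fact /f mulrA [leRHS]mulrCA ler_wpM2l//.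
rewrite (le_trans (rnorm_mulmx_le _ _))// -mulrA ler_wpM2l//.
by rewrite ler_pM ?rnorm_ge0// rnorm_expmx_le.
Qed.

(** The defect of the product of partial sums is dominated by the scalar one, which vanishes in the
    limit by the functional equation of [expR]. *)
Lemma expmxD X Y : X *m Y = Y *m X -> expmx (X + Y) = expmx X *m expmx Y.
Proof.
move=> XY; apply: expmx_unique.
set a := N%:R * rnorm X; set b := N%:R * rnorm Y.
pose dX m := rnorm (expmx_sum X m - expmx X).
pose dY m := rnorm (expmx_sum Y m - expmx Y).
(* First the defect of the product of partial sums, then the cost of replacing the two factors by
   their limits, one at a time. *)
pose B m := N%:R * (real_expsum a m * real_expsum b m - real_expsum (a + b) m) +
  (N%:R * dX m * (rnorm (expmx Y) + dY m) + N%:R * rnorm (expmx X) * dY m).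
apply: (@squeeze_cvgr _ _ _ _ (fun=> 0) B).
- near=> m; rewrite rnorm_ge0 /=.
  rewrite -[expmx_sum (X + Y) m](subrK (expmx_sum X m *m expmx_sum Y m)) -addrA.
  rewrite (le_trans (rnormD _ _))// /B lerD//.
    by rewrite -rnormN opprB rnorm_expmx_sumM.
  have -> : expmx_sum X m *m expmx_sum Y m - expmx X *m expmx Y =
      (expmx_sum X m - expmx X) *m expmx_sum Y m +
      expmx X *m (expmx_sum Y m - expmx Y).
    by rewrite mulmxBl mulmxBr subrKA.
  rewrite (le_trans (rnormD _ _))// lerD ?rnorm_mulmx_le//.
  rewrite (le_trans (rnorm_mulmx_le _ _))// ler_wpM2l ?mulr_ge0 ?rnorm_ge0//.
  by rewrite -[X in rnorm X](subrK (expmx Y)) addrC rnormD.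
- exact: cvg_cst.
- have dX0 : dX m @[m --> \oo] --> (0 : R) by exact: expmx_sum_cvg.
  have dY0 : dY m @[m --> \oo] --> (0 : R) by exact: expmx_sum_cvg.
  have -> : (0 : R) = N%:R * (expR a * expR b - expR (a + b)) +
      (N%:R * 0 * (rnorm (expmx Y) + 0) + N%:R * rnorm (expmx X) * 0).
    by rewrite expRD subrr !(mulr0, mul0r, addr0).
  apply: cvgD.
    by apply: cvgMr; apply: cvgB => //; apply: cvgM.
  apply: cvgD; last exact: (cvgMr dY0).
  by apply: cvgM; [exact: (cvgMr dX0)|apply: cvgD; [exact: cvg_cst|exact: dY0]].
Unshelve. all: by end_near. Qed.

End expmx_theory.

(** * Mean value inequalities and Lipschitz bounds *)

Section mean_value.
Context {R : realType}.
Implicit Type V W : normedModType R[i].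

Lemma rnorm_distC V (u v : V) : rnorm (u - v) = rnorm (v - u).
Proof. by rewrite -rnormN opprB. Qed.

Lemma nbhs_rnorm V (x : V) (Q : set V) : nbhs x Q ->
  exists2 d : R, 0 < d & forall y, rnorm (y - x) < d -> Q y.
Proof.
move=> /nbhs_normP [e /= e0 eQ].
have e_real : (complex.Re e)%:C = e by rewrite RRe_real// gtr0_real.
exists (complex.Re e); first by rewrite -ltcR e_real.
by move=> y xy; apply: eQ => /=; rewrite distrC -rnormE -e_real ltcR.
Qed.

Lemma within_continuous_rnorm V (A : set R) (g : R -> V) :
  {within A, continuous g} -> {within A, continuous (fun t => rnorm (g t))}.
Proof.
move=> cg x; apply: (@continuous_comp (subspace A) V R); first exact: cg.
exact: rnorm_continuous.
Qed.

Lemma within_continuous_bounded V (T : R) (g : R -> V) : 0 <= T ->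
  {within `[0, T], continuous g} ->
  exists B : R, forall t : R, 0 <= t <= T -> rnorm (g t) <= B.
Proof.
move=> T0 /within_continuous_rnorm /(EVT_max T0)[c _ gc].
by exists (rnorm (g c)) => t tT; apply: gc; rewrite in_itv.
Qed.

(** The hypothesis is what a derivative of norm at most [C] supplies, one-sided at the end points.
    This form serves both curves in time and segments in the state space. *)
Lemma rnorm_mean_value V (g : R -> V) (a b C : R) : a <= b ->
  (forall t e : R, a <= t <= b -> 0 < e -> exists2 d : R, 0 < d &
    forall s : R, a <= s <= b -> `|s - t| < d ->
      rnorm (g s - g t) <= (C + e) * `|s - t|) ->
  rnorm (g b - g a) <= C * (b - a).
Proof.
move=> ab gC.
suff gCe (e : R) : 0 < e -> rnorm (g b - g a) <= (C + e) * (b - a).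
  apply/ler_addgt0Pr => e e0.
  have ba : 0 < b - a + 1 by rewrite ltr_wpDl ?subr_ge0.
  have := gCe (e / (b - a + 1)); rewrite divr_gt0// => /(_ isT) /le_trans; apply.
  rewrite mulrDl lerD2l -mulrA ler_piMr ?(ltW e0)// mulrC.
  by rewrite ler_pdivrMr// mul1r lerDl.
move=> e0.
(* N is maximal at a: just to the left of any other point, the difference
   quotient is below C + e. *)
pose N (t : R) := rnorm (g t - g a) - (C + e) * t.
have N_le (s t : R) : rnorm (g t - g a) <= rnorm (g s - g a) + rnorm (g s - g t).
  by rewrite (rnorm_distC (g s) (g t)) [leRHS]addrC -(subrKA (g s) (g t) (- g a)) rnormD.
(* For the continuity of [N]: the first term accounts for [g], by the hypothesis with tolerance 1,
   the second for the linear term of [N]. *)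
pose M := `|C + 1| + `|C + e|.
have M_ge0 : 0 <= M by rewrite addr_ge0.
have N_lip (s t : R) : rnorm (g s - g t) <= (C + 1) * `|s - t| ->
    `|N t - N s| <= M * `|s - t|.
  move=> gst; have gst' : rnorm (g s - g t) <= `|C + 1| * `|s - t|.
    by rewrite (le_trans gst)// ler_wpM2r// ler_norm.
  have : `|(C + e) * (s - t)| <= `|C + e| * `|s - t| by rewrite normrM.
  have := N_le s t; have := N_le t s; rewrite [rnorm (g t - g s)]rnorm_distC.
  move=> Nst Nts /ler_normlP[Cst1 Cst2].
  by apply/ler_normlP; rewrite /N /M; split; lra.
have N_cont : {within `[a, b], continuous N}.
  apply/subspace_continuousP => t /=; rewrite in_itv /= => tab.
  have [d d0 gd] := gC t 1 tab ltr01.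
  apply/cvgrPdist_le => r r0.
  pose d' := Num.min d (r / (M + 1)).
  have d'0 : 0 < d' by rewrite lt_min d0 divr_gt0// ltr_wpDl.
  apply/nbhs_normP; exists d' => //= s; rewrite /= [`|t - s|]distrC lt_min.
  move=> /andP[sd sr].
  rewrite in_itv /= => sab.
  apply: (@le_trans _ _ (M * `|s - t|)); last first.
    rewrite (le_trans (ler_wpM2l M_ge0 (ltW sr)))// mulrCA ler_piMr ?(ltW r0)//.
    by rewrite ler_pdivrMr ?ltr_wpDl// mul1r lerDl.
  exact: N_lip (gd s sab sd).
have [c] := EVT_max ab N_cont; rewrite in_itv /= => /andP[ac cb] cN.
have [ca|ca] := eqVneq c a.
  have := cN b; rewrite in_itv /= ab lexx => /(_ isT).
  by rewrite /N ca subrr rnorm0; lra.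
have {}ac : a < c by rewrite lt_neqAle eq_sym ca.
(* With slope at most [C + e / 2] near [c], a point [s] just left of [c] has [N s] above [N c] by at
   least [e / 2 * (c - s)], which contradicts the maximality of [c]. *)
have [d d0 gd] := gC c (e / 2) (introT andP (conj (ltW ac) cb)) ltac:(lra).
pose s := Num.max a (c - d / 2).
have as_ : a <= s by rewrite le_max lexx.
have sc : s < c by rewrite gt_max ac /=; lra.
have cs : c - d / 2 <= s by rewrite le_max lexx orbT.
have sab : a <= s <= b by rewrite as_ (le_trans (ltW sc)).
have sdist : `|s - c| = c - s by rewrite distrC ger0_norm// subr_ge0 ltW.
have := gd s sab; rewrite sdist => /(_ ltac:(lra)) gsc.
have := cN s; rewrite in_itv /= sab => /(_ isT); rewrite /N => Nsc.
have := N_le s c => Ncs.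
have : 0 < e / 2 * (c - s) by rewrite mulr_gt0 ?divr_gt0// subr_gt0.
lra.
Qed.

Lemma derivative_on_le V (T : R) (g g' : R -> V) : derivative_on T g g' ->
  forall t e : R, 0 <= t <= T -> 0 < e -> exists2 d : R, 0 < d &
    forall s : R, 0 <= s <= T -> `|s - t| < d ->
      rnorm (g s - g t - (s - t)%:C *: g' t) <= e * `|s - t|.
Proof.
move=> gg' t e tT e0; have e0' : 0 < e%:C by rewrite ltcR.
have /cvgrPdistC_le /(_ _ e0') /nbhs_normP [d /= d0 gd] := gg' t tT.
exists d => // s sT st; have [->|s_t] := eqVneq s t.
  by rewrite !subrr scale0r subr0 rnorm0 normr0 mulr0.
have := gd s; rewrite /= distrC => /(_ st s_t); rewrite in_itv /= => /(_ sT).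
rewrite -rnormE lecR; have st0 : s - t != 0 by rewrite subr_eq0.
move=> /(ler_wpM2r (normr_ge0 (s - t))); rewrite mulrC -rnormZr.
rewrite scalerBr scalerA -rmorphM /= divff//.
by rewrite rmorph1 scale1r.
Qed.

(** Serves to identify the continuous derivative given by [C1_on] with the right-hand side of the
    evolution equation. *)
Lemma derivative_on_unique V (T : R) (g g1 g2 : R -> V) : 0 < T ->
  derivative_on T g g1 -> derivative_on T g g2 ->
  forall t : R, 0 <= t <= T -> g1 t = g2 t.
Proof.
move=> T0 /derivative_on_le gg1 /derivative_on_le gg2 t tT.
apply/eqP; rewrite -subr_eq0; apply/eqP/rnorm_eq0/eqP.
rewrite eq_le rnorm_ge0 andbT; apply/ler_addgt0Pr => e e0; rewrite add0r.
have e20 : 0 < e / 2 by rewrite divr_gt0.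
have [d1 d10 gd1] := gg1 t _ tT e20; have [d2 d20 gd2] := gg2 t _ tT e20.
have [s [sT st s1 s2]] : exists s, [/\ 0 <= s <= T, s != t, `|s - t| < d1 & `|s - t| < d2].
  (* A step of length [r] towards the farther end point stays in [[0, T]], so the one-sided limits
     at the ends are covered too. *)
  pose r := Num.min (T / 2) (Num.min d1 d2 / 2).
  have r0 : 0 < r by rewrite lt_min !divr_gt0// lt_min d10.
  have rT : r <= T / 2 by rewrite ge_min lexx.
  have rd : r < Num.min d1 d2.
    rewrite (@le_lt_trans _ _ (Num.min d1 d2 / 2))// ?ge_min ?lexx ?orbT//.
    have : 0 < Num.min d1 d2 by rewrite lt_min d10.
    by lra.
  move: rd; rewrite lt_min => /andP[rd1 rd2].
  have [tT2|tT2] := leP t (T / 2).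
    exists (t + r); rewrite addrAC subrr add0r gtr0_norm// rd1 rd2.
    by split => //; [lra|rewrite gt_eqF// ltrDl].
  exists (t - r); rewrite addrAC subrr add0r normrN gtr0_norm// rd1 rd2.
  by split => //; [lra|rewrite lt_eqF// ltrBlDr ltrDl].
have st0 : 0 < `|s - t| by rewrite normr_gt0 subr_eq0.
rewrite -(ler_pM2l st0) -rnormZr scalerBr.
have -> : (s - t)%:C *: g1 t - (s - t)%:C *: g2 t =
  (g s - g t - (s - t)%:C *: g2 t) - (g s - g t - (s - t)%:C *: g1 t).
  by rewrite opprB [RHS]addrC subrKA.
rewrite (le_trans (rnormD _ _))// rnormN.
have := gd1 s sT s1; have := gd2 s sT s2; lra.
Qed.

Lemma derivative_on_lipschitz V (T B : R) (g g' : R -> V) :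
  derivative_on T g g' -> (forall t : R, 0 <= t <= T -> rnorm (g' t) <= B) ->
  forall s t : R, 0 <= s -> s <= t -> t <= T -> rnorm (g t - g s) <= B * (t - s).
Proof.
move=> gg' gB s t s0 st tT; apply: rnorm_mean_value => // r e /andP[sr rt] e0.
have rT : 0 <= r <= T by rewrite (le_trans s0) ?(le_trans rt).
have [d d0 gd] := derivative_on_le gg' rT e0; exists d => // q /andP[sq qt] qr.
have qT : 0 <= q <= T by rewrite (le_trans s0) ?(le_trans qt).
rewrite -[g q - g r](subrK ((q - r)%:C *: g' r)) (le_trans (rnormD _ _))//.
by rewrite mulrDl addrC lerD ?gd// rnormZr mulrC ler_wpM2r ?gB.
Qed.

Lemma C1_on_bounded V (T : R) (g : R -> V) : 0 <= T -> C1_on T g ->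
  exists B : R, [/\ 0 <= B, forall t : R, 0 <= t <= T -> rnorm (g t) <= B &
    forall s t : R, 0 <= s -> s <= t -> t <= T -> rnorm (g t - g s) <= B * (t - s)].
Proof.
move=> T0 [g' gg' /(within_continuous_bounded T0)[B gB]].
have B0 : 0 <= B by apply: le_trans (gB 0 _); rewrite ?rnorm_ge0 ?lexx.
have lip := derivative_on_lipschitz gg' gB.
(* The first two terms bound the values of [g]; the last makes the same number a Lipschitz
   constant. *)
exists (rnorm (g 0) + B * T + B); split.
- by rewrite !addr_ge0 ?rnorm_ge0 ?mulr_ge0.
- move=> t /andP[t0 tT]; rewrite -[g t](subrK (g 0)).
  rewrite (le_trans (rnormD _ _))// addrC -addrA lerD2l.
  rewrite (le_trans (lip _ _ (lexx _) t0 tT))// subr0 ler_wpDr//.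
  by rewrite ler_wpM2l.
- move=> s t s0 st tT; rewrite (le_trans (lip _ _ s0 st tT))// ler_wpM2r ?subr_ge0//.
  by rewrite lerDr addr_ge0 ?rnorm_ge0 ?mulr_ge0.
Qed.

(** Mean value inequality along the segment from [x] to [y] at a frozen time: only a bound of [fv]
    on that segment enters, so the tube around the solution may be thin. *)
Lemma C1_with_lipschitz V W (T L t : R) (f ft : R -> V -> W)
    (fv : R -> V -> V -> W) (x y : V) :
  C1_with T f ft fv -> 0 <= t <= T ->
  (forall r : R, 0 <= r <= 1 -> opnorm (fv t (x + r%:C *: (y - x))) <= L) ->
  rnorm (f t y - f t x) <= L * rnorm (y - x).
Proof.
move=> [fv_lin f_diff _ _] tT fvL.
pose z (r : R) := x + r%:C *: (y - x).
have zB q r : z q - z r = (q - r)%:C *: (y - x).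
  by rewrite /z opprD addrACA subrr add0r -scalerBl rmorphB.
have -> : f t y - f t x = f t (z 1) - f t (z 0).
  by rewrite /z rmorph0 rmorph1 scale1r scale0r addr0 [x + _]addrC subrK.
rewrite -[leRHS]mulr1 -[X in _ * X](subr0 1).
apply: (rnorm_mean_value (g := fun r => f t (z r))) => // r e r01 e0.
have [fvD fvC] := fv_lin t (z r) tT.
have fv0 : fv t (z r) 0 = 0.
  have := fvD 1 0 0; rewrite rmorph1 !scale1r addr0 => /eqP.
  by rewrite -subr_eq subrr => /eqP.
have fvZ (a : R) v : fv t (z r) (a%:C *: v) = a%:C *: fv t (z r) v.
  by have := fvD a v 0; rewrite fv0 !addr0.
have fv_le := ler_opnorm_continuous fvZ (fvC 0).
pose m := rnorm (y - x).
have m_ge0 : 0 <= m by exact: rnorm_ge0.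
have m10 : 0 < m + 1 by rewrite ltr_wpDl.
(* Increments of [z] are [m] times those of the parameter, so this tolerance costs at most [e] per
   unit of parameter; the [+ 1] covers [m = 0]. *)
have em0 : 0 < e / (m + 1) by rewrite divr_gt0.
have /cvgr0Pnorm_le /(_ _ em0) fz := f_diff t (z r) tT.
have tz_cvg : (t, w) @[w --> z r] --> (t, z r).
  by apply: (cvg_pair (G := nbhs t) (H := nbhs (z r))); [exact: cvg_cst|exact: cvg_id].
have /nbhs_rnorm [d d0 fd] := tz_cvg _ fz.
exists (d / (m + 1)); first by rewrite divr_gt0.
move=> q q01 qr.
have zqr : rnorm (z q - z r) = `|q - r| * m by rewrite zB rnormZr.
have qm_le : `|q - r| * m <= `|q - r| * (m + 1).
  by rewrite ler_wpM2l// lerDl.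
have := fd (z q); rewrite zqr => /(_ _ tT) /=.
rewrite subrr scale0r add0r normr0 add0r => fqr.
have {}fqr := fqr ltac:(
  by rewrite (le_lt_trans qm_le)// -ltr_pdivlMr).
have {}fqr : rnorm (f t (z q) - f t (z r) - fv t (z r) (z q - z r)) <=
    e / (m + 1) * (`|q - r| * m).
  (* Where the two points coincide, the quotient in [C1_with] has denominator 0 and carries no
     information, but all increments vanish. *)
  have [qr0|qr0] := eqVneq (`|q - r| * m) 0.
    have zz0 : z q - z r = 0 by apply: rnorm_eq0; rewrite zqr.
    by rewrite zz0 fv0 (subr0_eq zz0) !subrr rnorm0 qr0 mulr0.
  rewrite -ler_pdivrMr; last by rewrite lt0r qr0 mulr_ge0.
  by move: fqr; rewrite zqr; apply: le_trans; exact: ler_norm.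
rewrite -[f t (z q) - _](subrK (fv t (z r) (z q - z r))).
rewrite (le_trans (rnormD _ _))// mulrDl addrC lerD//.
  rewrite (le_trans (fv_le _))// zqr mulrA mulrAC ler_wpM2r//.
  by rewrite ler_wpM2r ?fvL.
rewrite (le_trans fqr)// mulrCA [leRHS]mulrC ler_wpM2l// mulrAC.
by rewrite ler_pdivrMr// ler_wpM2l ?(ltW e0)// lerDl.
Qed.

End mean_value.

(** * Exponentials as a one-parameter group, and the recurrence they drive *)

Section one_parameter_group.
Context {R : realType} {N : nat}.
Variable A : 'M[R[i]]_N.

Lemma mulmx_expmx_scaleC (t : R) :
  A *m expmx (t%:C *: A) = expmx (t%:C *: A) *m A.
Proof. by apply: mulmx_expmxC; rewrite -scalemxAr -scalemxAl. Qed.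

Lemma expmx_scaleD (t u : R) :
  expmx ((t + u)%:C *: A) = expmx (t%:C *: A) *m expmx (u%:C *: A).
Proof.
have -> : (t + u)%:C *: A = t%:C *: A + u%:C *: A.
  by rewrite -scalerDl; congr (_ *: _); exact: rmorphD.
rewrite expmxD; first by [].
by rewrite -!scalemxAr -!scalemxAl scalerA mulrC -scalerA.
Qed.

Lemma expmx_scale0 : expmx ((0 : R)%:C *: A) = 1%:M.
Proof. by rewrite rmorph0 scale0r expmx0. Qed.

End one_parameter_group.

(** Discrete variation of constants. The sum is indexed by age: the contribution of step [n - r.+1]
    has since been propagated [r] times. *)
Lemma semigroup_recurrence (R : realType) N (E : R -> 'M[R[i]]_N) (k : R)
    (U F : nat -> 'cV[R[i]]_N) n :
  E 0 = 1%:M -> (forall t u, E (t + u) = E t *m E u) ->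
  (forall m, (m < n)%N -> U m.+1 = E k *m U m + F m) ->
  U n = E (n%:R * k) *m U 0 +
    \sum_(0 <= r < n) E (r%:R * k) *m F (n - r.+1)%N.
Proof.
move=> E0 ED; have ES r : E (r.+1%:R * k) = E k *m E (r%:R * k).
  by rewrite -ED -[X in _ = E (X + _)]mul1r -mulrDl -natr1 addrC.
elim: n => [|n IH] UF.
  by rewrite mul0r E0 mul1mx big_nil addr0.
rewrite UF// IH => [|m mn]; last by apply: UF; rewrite ltnS ltnW.
rewrite ES mulmxDr mulmxA -addrA; congr (_ + _).
rewrite [RHS]big_nat_recl//= mul0r E0 mul1mx subSS subn0 addrC.
congr (_ + _); rewrite mulmx_sumr; apply: eq_bigr => r _.
by rewrite mulmxA ES subSS.
Qed.

(** * Summation by parts, Gronwall and stage estimates *)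

Section discrete_estimates.
Context {R : realType}.

(** Freezing all weights at [w 0] costs one increment of size at most [e] per step, each multiplied
    by a partial sum of norm at most [C]. *)
Lemma summation_by_parts_le N (a : nat -> 'M[R[i]]_N) (w : nat -> 'cV[R[i]]_N)
    (n : nat) (C e : R) :
  (forall m, (m <= n)%N -> mxopnorm (\sum_(1 <= r < m) a r) <= C) ->
  (forall j, (j.+1 < n)%N -> rnorm (w j.+1 - w j) <= e) -> 0 <= e ->
  rnorm (\sum_(1 <= r < n) a r *m w (n - r.+1)%N - (\sum_(1 <= r < n) a r) *m w 0)
    <= n%:R * (C * e).
Proof.
move=> + + e0; elim: n w => [|n IH] w aC we.
  by rewrite !big_geq// mul0mx subrr rnorm0 mul0r.
have C0 : 0 <= C.
  apply: le_trans (aC 0 isT); apply: (@opnorm_ge0 _ _ _ _ (N%:R * rnorm _)).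
    exact: mulmx0.
  exact: rnorm_mulmx_le.
have [->|n0] := posnP n.
  by rewrite !big_geq// mul0mx subrr rnorm0 mulr_ge0 ?mulr_ge0.
(* The shifted sequence freezes its weights at [w 1]; going back to [w 0] adds the single term
   [S *m (w 1 - w 0)]. *)
have {}IH := IH (fun j => w j.+1) (fun m mn => aC m (leqW mn)) (fun j jn => we j.+1 jn).
rewrite !(@big_nat_recr _ _ _ n)//= subnn.
have -> : \sum_(1 <= r < n) a r *m w (n.+1 - r.+1)%N =
    \sum_(1 <= r < n) a r *m w (n - r.+1).+1.
  by apply: eq_big_nat => r /andP[_ rn]; rewrite subSS subnSK.
set T := \sum_(1 <= r < n) a r *m _ in IH *; set S := \sum_(1 <= r < n) a r in IH *.
have -> : T + a n *m w 0 - (S + a n) *m w 0 = (T - S *m w 1) + S *m (w 1 - w 0).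
  by rewrite mulmxDl mulmxBr [S *m w 0 + _]addrC opprD addrA addrK subrKA.
rewrite (le_trans (rnormD _ _))// -[n.+1%:R]natr1 mulrDl mul1r lerD//.
rewrite (le_trans (ler_mxopnorm _ _))//.
rewrite (@le_trans _ _ (C * rnorm (w 1 - w 0)))//.
  by rewrite ler_wpM2r ?rnorm_ge0 ?aC.
by rewrite ler_wpM2l ?we.
Qed.

(** [D * (1 + e) ^+ n] solves the recurrence with equality, and strong induction compares [x] with
    it. *)
Lemma discrete_gronwall (x : nat -> R) (D e : R) n : 0 <= e ->
  (forall m, (m <= n)%N -> x m <= D + e * \sum_(0 <= j < m) x j) ->
  x n <= D * (1 + e) ^+ n.
Proof.
move=> e0; elim/ltn_ind: n => n IH xD.
rewrite (le_trans (xD n (leqnn _)))//.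
have geom m : D * (1 + e) ^+ m = D + e * \sum_(0 <= j < m) D * (1 + e) ^+ j.
  elim: m => [|m IHm]; first by rewrite big_geq// expr0 mulr1 mulr0 addr0.
  rewrite big_nat_recr//= mulrDr addrA -IHm exprS; ring.
rewrite geom lerD2l ler_wpM2l//; apply: ler_sum_nat => j /andP[_ jn].
by apply: IH => // m mj; apply: xD; rewrite (leq_trans mj)// ltnW.
Qed.

(** Since a stage depends on earlier ones only, each stage multiplies the bound by one more factor
    [q]. The 2 comes from bounding [X] and [x j] by the same power of [q] times [X]. *)
Lemma stage_bound s (a : 'I_s -> 'I_s -> R) (x : 'I_s -> R) (X p : R) :
  0 <= X -> 0 <= p ->
  (forall i, x i <= X + \sum_(j < s | (j < i)%N) `|a i j| * (p * (X + x j))) ->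
  forall i, x i <= (1 + 2 * p * \sum_i \sum_j `|a i j|) ^+ s * X.
Proof.
move=> X0 p0 xX; set al := \sum_i _; set q := 1 + _.
have al0 : 0 <= al by apply: sumr_ge0 => i _; exact: sumr_ge0.
have q1 : 1 <= q by rewrite lerDl !mulr_ge0.
have q_le l m : (l <= m)%N -> q ^+ l * X <= q ^+ m * X.
  by move=> lm; rewrite ler_wpM2r// ler_weXn2l.
(* Stages are numbered from 0, so stage [n] carries [n.+1] factors, at most [s]. *)
suff xq n (i : 'I_s) : i = n :> nat -> x i <= q ^+ n.+1 * X.
  by move=> i; rewrite (le_trans (xq i i erefl))// q_le.
elim/ltn_ind: n i => n IH i i_n.
rewrite (le_trans (xX i))//.
have -> : q ^+ n.+1 * X = q ^+ n * X + q ^+ n * (2 * p * al * X).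
  by rewrite exprS {1}/q; ring.
rewrite lerD//.
  by rewrite -[leLHS]mul1r -(expr0 q) q_le.
have -> : q ^+ n * (2 * p * al * X) = al * (p * (2 * (q ^+ n * X))) by ring.
rewrite [in leRHS]/al [in leRHS](bigD1 i)//= mulrDl ler_wpDr//.
  rewrite mulr_ge0 ?sumr_ge0// => [j _|]; first exact: sumr_ge0.
  by rewrite !mulr_ge0// exprn_ge0// (le_trans _ q1).
rewrite mulr_suml [leRHS](bigID (fun j : 'I_s => (j < i)%N))/= ler_wpDr//.
  apply: sumr_ge0 => j _.
  by rewrite !mulr_ge0// exprn_ge0// (le_trans _ q1).
apply: ler_sum => j ji; rewrite !ler_wpM2l// mulr_natl mulr2n lerD//.
  by rewrite -[leLHS]mul1r -(expr0 q) q_le.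
by rewrite (le_trans (IH j _ j erefl)) ?q_le -?i_n.
Qed.

End discrete_estimates.

(** * The accumulated contribution of the boundary data *)

Section boundary_terms.
Context {R : realType} {Y : normedModType R[i]} {N : nat}.
Variables (A : 'M[R[i]]_N) (B : {linear Y -> 'cV[R[i]]_N}).
Hypothesis A_unit : A \in unitmx.
Variable E : R -> 'M[R[i]]_N.
Hypothesis E0 : E 0 = 1%:M.
Hypothesis ED : forall t u, E (t + u) = E t *m E u.
Hypothesis AE : forall t, A *m E t = E t *m A.
Hypothesis E_contraction : forall t : R, 0 <= t -> mxopnorm (E t) <= 1.
Hypothesis B_cont : continuous B.

Lemma rnorm_semigroup_le (t : R) (v : 'cV[R[i]]_N) : 0 <= t ->
  rnorm (E t *m v) <= rnorm v.
Proof.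
move=> t0; rewrite (le_trans (ler_mxopnorm _ _))// ler_piMl ?rnorm_ge0//.
exact: E_contraction.
Qed.

Lemma rnorm_linear_le y : rnorm (B y) <= opnorm B * rnorm y.
Proof.
by apply: ler_opnorm_continuous => [a v|]; [rewrite linearZ|exact: B_cont].
Qed.

Lemma opnorm_linear_ge0 : 0 <= opnorm B.
Proof. by apply: opnorm_ge0 rnorm_linear_le; rewrite linear0. Qed.

Lemma rnorm_solve_le y :
  rnorm (invmx A *m B y) <= opnorm (fun y => invmx A *m B y) * rnorm y.
Proof.
apply: (@ler_opnorm _ _ _ (fun y => invmx A *m B y)
  (N%:R * rnorm (invmx A) * opnorm B)) => [a v|v].
  by rewrite linearZ -scalemxAr.
rewrite (le_trans (rnorm_mulmx_le _ _))// -[leRHS]mulrA.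
rewrite ler_wpM2l ?rnorm_linear_le//.
by rewrite mulr_ge0 ?rnorm_ge0.
Qed.

(** Treats one node [c] of the tableau. Samples of the data at successive steps differ by [O(k)], so
    summation by parts applies; [opnorm B] enters only through the newest term. *)
Lemma boundary_sum_le (k c C C' G : R) n (y : nat -> Y) :
  0 < k -> 0 <= c <= 1 -> 0 <= C' -> 0 <= G ->
  (forall m, (m <= n)%N -> mxopnorm (k%:C *: (A *m
    \sum_(1 <= r < m) E (r%:R * k))) <= C) ->
  opnorm (fun y => invmx A *m B y) <= C' ->
  (forall j, (j < n)%N -> rnorm (y j) <= G) ->
  (forall j, (j.+1 < n)%N -> rnorm (y j.+1 - y j) <= G * k) ->
  rnorm (k%:C *: \sum_(0 <= r < n) E (r%:R * k) *m
    (E ((1 - c) * k) *m B (y (n - r.+1)%N))) <=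
  k * opnorm B * G + C * (C' * G) * (1 + n%:R * k).
Proof.
move=> k0 /andP[c0 c1] C'0 G0 SC AB yG yL.
have C0 : 0 <= C.
  apply: le_trans (SC 0 isT); apply: (@opnorm_ge0 _ _ _ _ (N%:R * rnorm _)).
    exact: mulmx0.
  exact: rnorm_mulmx_le.
have [->|n0] := posnP n.
  rewrite big_geq// scaler0 rnorm0 mul0r addr0 mulr1.
  by rewrite addr_ge0 ?mulr_ge0 ?(ltW k0) ?opnorm_linear_ge0.
have c1k : 0 <= (1 - c) * k by rewrite mulr_ge0 ?subr_ge0 ?(ltW k0).
pose w j := invmx A *m B (y j).
pose a r := k%:C *: (A *m E (r%:R * k)).
have aC m : (m <= n)%N -> mxopnorm (\sum_(1 <= r < m) a r) <= C.
  by move=> mn; rewrite /a -scaler_sumr -mulmx_sumr SC.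
have w_le j : (j < n)%N -> rnorm (w j) <= C' * G.
  move=> jn; rewrite (le_trans (rnorm_solve_le _))//.
  rewrite (@le_trans _ _ (C' * rnorm (y j)))//.
    by rewrite ler_wpM2r ?rnorm_ge0.
  by rewrite ler_wpM2l ?yG.
have dw_le j : (j.+1 < n)%N -> rnorm (w j.+1 - w j) <= C' * G * k.
  move=> jn; rewrite /w -mulmxBr -linearB (le_trans (rnorm_solve_le _))//.
  rewrite (@le_trans _ _ (C' * rnorm (y j.+1 - y j)))//.
    by rewrite ler_wpM2r ?rnorm_ge0.
  by rewrite -mulrA ler_wpM2l ?yL.
(* The sums in the hypothesis start at [r = 1]; the term [r = 0] is bounded directly and yields
   [k * opnorm B * G]. *)
rewrite big_ltn// mul0r E0 mul1mx scalerDr.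
rewrite (le_trans (rnormD _ _))// lerD//.
  rewrite rnormZr gtr0_norm// -mulrA ler_wpM2l ?(ltW k0)//.
  rewrite (le_trans (rnorm_semigroup_le _ c1k))//.
  rewrite (le_trans (rnorm_linear_le _))// ler_wpM2l ?opnorm_linear_ge0//.
  by rewrite yG// subn1 prednK.
(* Insert [A *m invmx A] before [B] and pull out the common contraction, which commutes with
   everything but [B]. *)
have -> : k%:C *: \sum_(1 <= r < n) E (r%:R * k) *m
      (E ((1 - c) * k) *m B (y (n - r.+1)%N)) =
    E ((1 - c) * k) *m \sum_(1 <= r < n) a r *m w (n - r.+1)%N.
  rewrite scaler_sumr mulmx_sumr; apply: eq_bigr => r _.
  rewrite /a -scalemxAl -scalemxAr; congr (_ *: _).
  rewrite [A *m _]AE -(mulmxA _ A) (mulKVmx A_unit) !mulmxA.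
  by rewrite -!ED addrC.
rewrite (le_trans (rnorm_semigroup_le _ c1k))//.
set s := \sum_(1 <= r < n) _.
rewrite -[s](subrK ((\sum_(1 <= r < n) a r) *m w 0)) (le_trans (rnormD _ _))//.
have -> : C * (C' * G) * (1 + n%:R * k) = n%:R * (C * (C' * G * k)) + C * (C' * G).
  by ring.
rewrite lerD ?summation_by_parts_le// ?mulr_ge0 ?(ltW k0)//.
rewrite (le_trans (ler_mxopnorm _ _))//.
rewrite (@le_trans _ _ (C * rnorm (w 0)))//.
  by rewrite ler_wpM2r ?rnorm_ge0 ?aC.
by rewrite ler_wpM2l ?w_le.
Qed.

End boundary_terms.

(** * Bounds on grid values and on the exact solution *)

Section grid_values.
Context {R : realType} {d : nat} {O : bounded_domain R d}.

(* If the values of v were unbounded, their supremum would be the junk value 0,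
   and the norm axioms would force v = 0. *)
Lemma rnorm_value_le (v : Cbar O) x : @rnorm R R[i] (v x) <= rnorm v.
Proof.
have -> : rnorm v = max_norm v by [].
have [ub|nub] := pselect (has_ubound [set rnorm (v x : R[i]) | x in [set: closure O]]).
  by apply: ub_le_sup => //; exists x.
have v0 : max_norm v = 0 by apply: sup_out => -[].
have v_eq0 : v = 0 by apply: rnorm_eq0; exact: v0.
by rewrite v0 v_eq0 (_ : (0 : Cbar O) x = 0)// rnorm0.
Qed.

Lemma rnorm_Ph_le (Y : completeNormedModType R[i]) (D : discretization O Y) h
  (v : Cbar O) : rnorm (Ph D h v) <= rnorm v.
Proof.
apply: rnorm_mx_le; first exact: rnorm_ge0.
by move=> i j; rewrite mxE; exact: rnorm_value_le.
Qed.

End grid_values.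

Section solution_bounds.
Context {R : realType} {d : nat} {O : bounded_domain R d}
  {Y : completeNormedModType R[i]} {P : ibvp O Y}.

(** Along the solution the source equals [u' - A u], a difference of two continuous functions on a
    compact interval. *)
Lemma source_sol_bounded : continuous_hyps P ->
  exists B : R, forall t : R, 0 <= t <= Tend P ->
    rnorm (source P t (sol P t)) <= B.
Proof.
move=> hP; have T0 := Tend_gt0 hP.
have [u' uu' /(within_continuous_bounded (ltW T0))[B1 u'B]] := sol_C1 hP.
have [B2 AuB] := within_continuous_bounded (ltW T0) (opA_sol_continuous hP).
exists (B1 + B2) => t tT.
have u'E := derivative_on_unique T0 uu' (sol_eq (sol_solution hP)) tT.
have -> : source P t (sol P t) = u' t - opA P (sol P t).
  by rewrite u'E addrC addKr.
by rewrite (le_trans (rnormD _ _))// rnormN lerD ?u'B ?AuB.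
Qed.

End solution_bounds.

(** * Scalar inequalities collecting the constants *)

(** Gives a stage term the shape required by [stage_bound]: [X] absorbs [k * b] and the constants,
    [T] absorbs [k]. The products supplied to [lra] are its atoms. *)
Lemma stage_term_le (R : realFieldType) (k T b g c l X x : R) :
  0 <= k -> k <= T -> 0 <= g -> 0 <= c -> 0 <= l -> 0 <= x -> 1 <= X ->
  k * b <= X ->
  k * (b * g + (c + l * x)) <= (g + T * (c + l)) * (X + x).
Proof.
move=> k0 kT g0 c0 l0 x0 X1 kbX; have T0 : 0 <= T by exact: le_trans kT.
have X0 : 0 <= X by exact: le_trans X1.
have := ler_wpM2r g0 kbX; have := ler_wpM2r c0 kT.
have := ler_wpM2r (mulr_ge0 l0 x0) kT.
have := ler_wpM2l (mulr_ge0 T0 c0) X1.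
have := mulr_ge0 g0 x0; have := mulr_ge0 (mulr_ge0 T0 c0) x0.
have := mulr_ge0 (mulr_ge0 T0 l0) X0.
lra.
Qed.

(** Prepares Gronwall: [m * k] is absorbed by [T], everything free of [S] by a multiple of [X], and
    [S] keeps a coefficient of order [k]. *)
Lemma global_term_le (R : realFieldType) (k m T b B g c l e X S : R) :
  0 <= m * k <= T -> 0 <= B -> 0 <= g -> 0 <= c -> 0 <= l ->
  0 <= e -> 0 <= b -> 1 <= X -> k * e <= X - 1 ->
  forall D : R, 0 <= D ->
  B + b * (k * e * g + D * (1 + m * k)) + k * b * (m * (c + l * X) + l * S) <=
  (B + b * (g + D * (1 + T)) + b * (T * (c + l))) * X + k * (b * l) * S.
Proof.
move=> /andP[mk0 mkT] B0 g0 c0 l0 e0 b0 X1 keX D D0.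
have T0 : 0 <= T by exact: le_trans mkT.
have X0 : 0 <= X by exact: le_trans X1.
have keX' : k * e <= X by rewrite (le_trans keX)// gerBl.
have := ler_wpM2l B0 X1.
have := ler_wpM2r (mulr_ge0 b0 g0) keX'.
have := ler_wpM2r (mulr_ge0 b0 D0) mkT.
have := ler_wpM2l (mulr_ge0 (mulr_ge0 b0 D0) T0) X1.
have := ler_wpM2l (mulr_ge0 b0 D0) X1.
have := ler_wpM2r (mulr_ge0 b0 c0) mkT.
have := ler_wpM2l (mulr_ge0 (mulr_ge0 b0 c0) T0) X1.
have := ler_wpM2r (mulr_ge0 (mulr_ge0 b0 l0) X0) mkT.
lra.
Qed.

(** * The bound on the global error *)

Theorem theorem7 (R : realType) (d : nat) (O : bounded_domain R d)
  (Y : completeNormedModType R[i]) (P : ibvp O Y) (D : discretization O Y)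
  (s : nat) (rk : tableau R s)
  (U : forall h, R -> nat -> 'cV[R[i]]_(nodes D h))
  (K : forall h, R -> nat -> 'I_s -> 'cV[R[i]]_(nodes D h))
  (h0 : R) :
  continuous_hyps P ->
  discretization_hyps P D ->
  (forall h k : R, mesh D h -> 0 < k -> lawson P rk k (U h k) (K h k)) ->
  fh_derivative_bounded P rk U K ->
  (exists2 t : R, 0 <= t <= Tend P & bdry P (sol P t) != 0) ->
  (forall i j : 'I_s, (i < j)%N -> rk_c rk i < rk_c rk j) ->
  (exists i, rk_c rk i = 1) ->
  0 < h0 ->
  (exists C' : R, forall tau h : R, 0 <= tau -> mesh D h -> h <= h0 ->
    mxopnorm (tau%:C *: (Ah D h *m expmx (tau%:C *: Ah D h))) <= C') ->
  C2_on (Tend P) (sol P) ->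
  (exists C : R, forall (h k : R) n, mesh D h -> h <= h0 -> 0 < k ->
    n%:R * k <= Tend P ->
    mxopnorm (k%:C *: (Ah D h *m
      \sum_(1 <= r < n) expmx ((r%:R * k)%:C *: Ah D h))) <= C) ->
  exists M : R, forall (h k : R) n, mesh D h -> h <= h0 -> 0 < k ->
    n%:R * k <= Tend P ->
    rnorm (U h k n - Ph D h (sol P (n%:R * k))) <=
      M * (1 + k * opnorm (Ch D h)).
Proof.
move=> hP hD hUK [L0 fL0] _ c_lt _ _ _ _ [Cs SC].
have T0 := Tend_gt0 hP; have T0' := ltW T0.
have [Bg [Bg0 gB g_lip]] := C1_on_bounded T0' (bdata_C1 hP).
have [Bu [Bu0 uB _]] := C1_on_bounded T0' (sol_C1 hP).
have [Bf0 fB0] := source_sol_bounded hP.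
have [CA0 AC0] := AhCh_bound hD.
(* Absolute values make the constants supplied by the hypotheses nonnegative. *)
pose L := `|L0|; pose Bf := `|Bf0|; pose CA := `|CA0|.
pose T := Tend P.
(* [p] is the constant of one stage term, [kap] the growth over all stages, [M1] collects the
   initial value and the boundary data, [M2] adds the source, and [M3] includes the Gronwall factor.
   The final [Bu] pays for the exact solution. *)
pose p := Bg + T * (Bf + L * Bu + L).
pose al := \sum_i \sum_j `|rk_a rk i j|.
pose kap := (1 + 2 * p * al) ^+ s.
pose be := \sum_i `|rk_b rk i|.
pose M1 := Bu + be * (Bg + `|Cs| * (CA * Bg) * (1 + T)).
pose M2 := M1 + be * (T * (Bf + L * Bu + L * kap)).
pose M3 := M2 * expR (T * (be * (L * kap))).
exists (M3 + Bu) => h k n hm hh0 k0 nkT.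
have L_ge0 : 0 <= L by exact: normr_ge0.
have Bf_ge0 : 0 <= Bf by exact: normr_ge0.
have CA_ge0 : 0 <= CA by exact: normr_ge0.
have p_ge0 : 0 <= p by rewrite !addr_ge0 ?mulr_ge0 ?addr_ge0 ?mulr_ge0.
have be_ge0 : 0 <= be by exact: sumr_ge0.
have al_ge0 : 0 <= al by apply: sumr_ge0 => i _; exact: sumr_ge0.
have kap_ge0 : 0 <= kap by rewrite exprn_ge0 ?addr_ge0 ?mulr_ge0.
set X := 1 + k * opnorm (Ch D h).
have B_cont : continuous (Ch D h) by exact: Ch_bounded hD h hm.
have B_ge0 : 0 <= opnorm (Ch D h) by exact: opnorm_linear_ge0.
have kB_ge0 : 0 <= k * opnorm (Ch D h) by rewrite mulr_ge0 ?(ltW k0).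
have X1 : 1 <= X by rewrite lerDl.
have X_ge0 : 0 <= X by exact: le_trans X1.
have M1_ge0 : 0 <= M1.
  by rewrite addr_ge0// mulr_ge0// addr_ge0// !mulr_ge0// addr_ge0.
have M2_ge0 : 0 <= M2.
  by rewrite addr_ge0// mulr_ge0// mulr_ge0// !addr_ge0// ?mulr_ge0.
have M3_ge0 : 0 <= M3 by rewrite mulr_ge0// expR_ge0.
have [U_init K_eq0 U_eq0] := hUK h k hm k0.
(* At [n = 0] the error is zero; otherwise one step fits in the interval, so [k <= T]. *)
have [n0|n_gt0] := posnP n.
  by rewrite n0 U_init mul0r subrr rnorm0 mulr_ge0 ?addr_ge0.
have kT : k <= T by rewrite (le_trans _ nkT)// ler_peMl ?(ltW k0)// ler1n.
have step_time m : (m < n)%N -> m.+1%:R * k <= T.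
  by move=> mn; rewrite (le_trans _ nkT)// ler_wpM2r ?(ltW k0)// ler_nat.
have stage_time m i : (m < n)%N -> 0 <= m%:R * k + rk_c rk i * k <= T.
  move=> mn; have /andP[c0 c1] := rk_c_itv rk i.
  rewrite addr_ge0 ?mulr_ge0 ?(ltW k0)//= (le_trans _ (step_time m mn))//.
  by rewrite -natr1 mulrDl lerD2l ler_wpM2r ?(ltW k0).
pose A := Ah D h; pose B := Ch D h; pose E (t : R) := expmx (t%:C *: A).
have A_unit : A \in unitmx by exact: (Ah_unit hD hm).
have E_contr (t : R) : 0 <= t -> mxopnorm (E t) <= 1 by exact: (Ah_contraction hD hm).
have E0 : E 0 = 1%:M by exact: expmx_scale0.
have ED t u : E (t + u) = E t *m E u by exact: expmx_scaleD.
have AE t : A *m E t = E t *m A by exact: mulmx_expmx_scaleC.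
have ASC m : (m <= n)%N ->
    mxopnorm (k%:C *: (A *m \sum_(1 <= r < m) E (r%:R * k))) <= `|Cs|.
  move=> mn; apply: le_trans (ler_norm _); apply: SC => //.
  by rewrite (le_trans _ nkT)// ler_wpM2r ?(ltW k0)// ler_nat.
have K_eq m i : (m < n)%N -> K h k m i = E (rk_c rk i * k) *m U h k m +
    k%:C *: \sum_(j < s | (j < i)%N) (rk_a rk i j)%:C *:
      (E ((rk_c rk i - rk_c rk j) * k) *m
        (B (bdata P (m%:R * k + rk_c rk j * k)) +
         fh D h (m%:R * k + rk_c rk j * k) (K h k m j))).
  by move=> mn; exact: K_eq0 (step_time m mn).
have U_eq m : (m < n)%N -> U h k m.+1 = E k *m U h k m +
    k%:C *: \sum_(i < s) (rk_b rk i)%:C *: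
      (E ((1 - rk_c rk i) * k) *m
        (B (bdata P (m%:R * k + rk_c rk i * k)) +
         fh D h (m%:R * k + rk_c rk i * k) (K h k m i))).
  by move=> mn; exact: U_eq0 (step_time m mn).
have AB_le : opnorm (fun y => invmx A *m B y) <= CA.
  by rewrite (le_trans (AC0 h hm))// ler_norm.
clearbody E; clear K_eq0 U_eq0.
have u_le (t : R) : 0 <= t <= T -> rnorm (Ph D h (sol P t)) <= Bu.
  by move=> tT; rewrite (le_trans (rnorm_Ph_le _ _ _))// uB.
have g_le (t : R) : 0 <= t <= T -> rnorm (B (bdata P t)) <= opnorm B * Bg.
  by move=> tT; rewrite (le_trans (rnorm_linear_le B_cont _))// ler_wpM2l// gB.
have fK_le m i : (m < n)%N ->
    rnorm (fh D h (m%:R * k + rk_c rk i * k) (K h k m i)) <=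
    Bf + L * Bu + L * rnorm (K h k m i).
  move=> mn; set t := _ + _; have tT : 0 <= t <= T by exact: stage_time.
  have [ft [fv [f_C1 fvL]]] := fL0 h hm.
  have [r [r0 _ Kr fvLr]] := fvL k (introT andP (conj k0 kT)).
  (* The segment from the exact value to the stage stays in the tube, as a ball is convex. *)
  have f_lip : rnorm (fh D h t (K h k m i) - fh D h t (Ph D h (sol P t))) <=
      L * rnorm (K h k m i - Ph D h (sol P t)).
    apply: (C1_with_lipschitz f_C1 tT) => q /andP[q0 q1].
    rewrite (le_trans _ (ler_norm L0))// fvLr// addrAC subrr add0r.
    rewrite rnormZr ger0_norm//; apply: le_lt_trans (Kr m i (step_time m mn)).
    by rewrite ler_piMl ?rnorm_ge0.
  have fu_le : rnorm (fh D h t (Ph D h (sol P t))) <= Bf.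
    rewrite -(fh_compat hD)// (le_trans (rnorm_Ph_le _ _ _))//.
    by rewrite (le_trans (fB0 t tT))// ler_norm.
  rewrite -[fh _ _ _ _](subrK (fh D h t (Ph D h (sol P t)))).
  rewrite (le_trans (rnormD _ _))// addrC -addrA lerD//.
  rewrite (le_trans f_lip)// -mulrDr ler_wpM2l//.
  by rewrite (le_trans (rnormD _ _))// rnormN addrC lerD2r u_le.
have K_le m i : (m < n)%N -> rnorm (K h k m i) <= kap * (rnorm (U h k m) + X).
  move=> mn; apply: (stage_bound (x := fun i => rnorm (K h k m i))) => //.
    by rewrite addr_ge0 ?rnorm_ge0// (le_trans _ X1).
  move=> {}i; rewrite K_eq// (le_trans (rnormD _ _))// lerD//.
    rewrite (le_trans (rnorm_semigroup_le E_contr _ _))//.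
      by rewrite mulr_ge0 ?(ltW k0)//; case/andP: (rk_c_itv rk i).
    by rewrite lerDl (le_trans _ X1).
  rewrite scaler_sumr (le_trans (rnorm_sum _ _ _))//; apply: ler_sum => j ji.
  rewrite scalerA mulrC -scalerA rnormZr ler_wpM2l// rnormZr gtr0_norm//.
  (* Increasing nodes make this exponent nonnegative, so the contraction bound applies. *)
  have cij : 0 <= (rk_c rk i - rk_c rk j) * k.
    by rewrite mulr_ge0 ?(ltW k0)// subr_ge0 ltW// c_lt.
  apply: (@le_trans _ _ (k * (opnorm B * Bg + (Bf + L * Bu + L * rnorm (K h k m j))))).
    rewrite ler_wpM2l ?(ltW k0)// (le_trans (rnorm_semigroup_le E_contr _ cij))//.
    rewrite (le_trans (rnormD _ _))// lerD ?fK_le// g_le//.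
    exact: stage_time.
  apply: stage_term_le => //; rewrite ?(ltW k0) ?rnorm_ge0 ?addr_ge0 ?mulr_ge0//.
    by rewrite (le_trans X1)// lerDr rnorm_ge0.
  by rewrite (le_trans (y := X))// ?lerDr ?rnorm_ge0 ?addr_ge0.
pose c := Bf + L * Bu; pose l := L * kap.
have c_ge0 : 0 <= c by rewrite addr_ge0 ?mulr_ge0.
have l_ge0 : 0 <= l by rewrite mulr_ge0.
pose t_ m i := m%:R * k + rk_c rk i * k.
(* The source contribution of step [m], separated from the boundary data because the triangle
   inequality suffices for it. *)
pose H m := k%:C *: \sum_(i < s) (rk_b rk i)%:C *:
  (E ((1 - rk_c rk i) * k) *m fh D h (t_ m i) (K h k m i)).
have c1k i : 0 <= (1 - rk_c rk i) * k.
  by rewrite mulr_ge0 ?(ltW k0)// subr_ge0; case/andP: (rk_c_itv rk i).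
have H_le m : (m < n)%N -> rnorm (H m) <= k * be * (c + l * X + l * rnorm (U h k m)).
  move=> mn; rewrite rnormZr gtr0_norm// -mulrA ler_wpM2l ?(ltW k0)//.
  rewrite (le_trans (rnorm_sum _ _ _))// mulr_suml; apply: ler_sum => i _.
  rewrite rnormZr ler_wpM2l// (le_trans (rnorm_semigroup_le E_contr _ (c1k i)))//.
  rewrite (le_trans (fK_le m i mn))// -[leRHS]addrA lerD2l -mulrDr /l -mulrA.
  by rewrite ler_wpM2l// [X + _]addrC K_le.
have U_le m : (m <= n)%N ->
    rnorm (U h k m) <= M2 * X + k * (be * l) * \sum_(0 <= j < m) rnorm (U h k j).
  move=> mn; have mkT : 0 <= m%:R * k <= T.
    rewrite mulr_ge0 ?(ltW k0)//= (le_trans _ nkT)//.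
    by rewrite ler_wpM2r ?(ltW k0)// ler_nat.
  have U_mn j : (j < m)%N -> U h k j.+1 = E k *m U h k j +
      (\sum_(i < s) (rk_b rk i)%:C *:
        (k%:C *: (E ((1 - rk_c rk i) * k) *m B (bdata P (t_ j i)))) + H j).
    move=> jm; rewrite U_eq ?(leq_trans jm)//; congr (_ + _).
    rewrite /H -[X in X + _](_ : k%:C *: \sum_(i < s) (rk_b rk i)%:C *:
        (E ((1 - rk_c rk i) * k) *m B (bdata P (t_ j i))) = _).
      rewrite -scalerDr -big_split; congr (_ *: _); apply: eq_bigr => i _.
      by rewrite mulmxDr scalerDr.
    rewrite scaler_sumr; apply: eq_bigr => i _.
    by rewrite !scalerA mulrC.
  rewrite (semigroup_recurrence E0 ED U_mn).
  rewrite (eq_bigr (fun r => \sum_(i < s) (rk_b rk i)%:C *: (k%:C *: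
      (E (r%:R * k) *m (E ((1 - rk_c rk i) * k) *m
        B (bdata P (t_ (m - r.+1)%N i))))) + E (r%:R * k) *m H (m - r.+1)%N));
    last first.
    move=> r _; rewrite mulmxDr mulmx_sumr; congr (_ + _).
    by apply: eq_bigr => i _; rewrite -!scalemxAr.
  (* The sum over steps becomes innermost, so that each node can be treated by [boundary_sum_le]. *)
  rewrite big_split/= exchange_big/=.
  have U0_le : rnorm (E (m%:R * k) *m U h k 0) <= Bu.
    case/andP: mkT => mk0 _; rewrite (le_trans (rnorm_semigroup_le E_contr _ mk0))//.
    by rewrite U_init u_le// lexx.
  have G_le i : rnorm (\sum_(0 <= r < m) (rk_b rk i)%:C *: (k%:C *:
      (E (r%:R * k) *m (E ((1 - rk_c rk i) * k) *m
        B (bdata P (t_ (m - r.+1)%N i)))))) <=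
      `|rk_b rk i| * (k * opnorm B * Bg + `|Cs| * (CA * Bg) * (1 + m%:R * k)).
    rewrite -!scaler_sumr rnormZr ler_wpM2l//.
    apply: (boundary_sum_le A_unit E0 ED AE E_contr B_cont k0 (rk_c_itv rk i)
      CA_ge0 Bg0 _ AB_le (y := fun j => bdata P (t_ j i))) => [q qm|j jm|j jm].
    - by rewrite ASC// (leq_trans qm).
    - by rewrite gB// stage_time// (leq_trans jm).
    - have /andP[t0 _] := stage_time j i (leq_trans (ltnW jm) mn).
      have /andP[_ t1] := stage_time j.+1 i (leq_trans jm mn).
      have tk : t_ j.+1 i - t_ j i = k by rewrite /t_ -natr1; ring.
      by rewrite -[X in _ * X]tk g_lip// -subr_ge0 tk ltW.
  have HS_le : rnorm (\sum_(0 <= r < m) E (r%:R * k) *m H (m - r.+1)%N) <=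
      k * be * (m%:R * (c + l * X) + l * \sum_(0 <= j < m) rnorm (U h k j)).
    rewrite (le_trans (rnorm_sum _ _ _))//.
    apply: (@le_trans _ _ (\sum_(0 <= r < m) rnorm (H (m - r.+1)%N))).
      apply: ler_sum => r _; apply: (rnorm_semigroup_le E_contr).
      by rewrite mulr_ge0 ?(ltW k0).
    (* Return from the age [r] to the step number [j = m - r.+1]. *)
    rewrite big_nat_rev/= add0n.
    apply: (@le_trans _ _ (\sum_(0 <= j < m)
        k * be * (c + l * X + l * rnorm (U h k j)))).
      apply: ler_sum_nat => j /andP[_ jm].
      by rewrite subnSK// subKn ?H_le ?(leq_trans jm)// ltnW.
    rewrite -mulr_sumr big_split/= -mulr_sumr sumr_const_nat subn0.
    by rewrite mulr_natl.
  rewrite (le_trans (rnormD _ _))//.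
  apply: le_trans (lerD U0_le (le_trans (rnormD _ _)
    (lerD (le_trans (rnorm_sum _ _ _) (ler_sum _ (fun i _ => G_le i))) HS_le))) _.
  rewrite -mulr_suml addrA /M2 /M1; apply: global_term_le => //.
  - by rewrite /X addrC addKr.
  - by rewrite !mulr_ge0.
have e_ge0 : 0 <= k * (be * l) by rewrite !mulr_ge0 ?(ltW k0).
have := discrete_gronwall e_ge0 U_le; move=> Un_le.
have Un_le' : rnorm (U h k n) <= M3 * X.
  rewrite (le_trans Un_le)// /M3 mulrAC ler_wpM2r ?ler_wpM2l//.
  (* [1 + x <= expR x] and [n%:R * k <= T] make the Gronwall factor independent of [n] and [k]. *)
  rewrite (@le_trans _ _ (expR (k * (be * l)) ^+ n))//.
    by rewrite lerXn2r ?nnegrE ?expR_ge0 ?expR_ge1Dx// addr_ge0.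
  rewrite -expRM_natl ler_expR mulrA ler_wpM2r// mulr_ge0//.
rewrite mulrDl (le_trans (rnormD _ _))// lerD// rnormN.
rewrite (le_trans (u_le _ _)) ?ler_peMr//.
by rewrite mulr_ge0 ?(ltW k0).
Qed.
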